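(* Let $n \geqslant 2$, $s,k\in\mathbb{Z}_+$, $0<\lambda<1$, $m\in\mathbb{Z}_+$, $n+m-1<\delta<n+m$, $T>0$ and $0\leqslant q\leqslant n-1$. Then every element of the image of the operator $d(\varPhi-\varPhi_m)$ acting from $Z^{2s+k,s,\lambda,0}_{\delta+1,\varLambda^{q+1}}$ to $Z^{2s+k,s,\lambda,0}_{\delta+1,\varLambda^{q+1}}$ (with $\varPhi=\varPhi_q$, $\varPhi_m=\varPhi_{m,q}$) can be represented in the form $$d\left(\sum_{|I|=q}\sum_{l=1}^{m+1}\sum_{j=1}^{J(l)}\frac{a_{I,l,j}(t)\,h_l^{(j)}(x)\,dx_I}{(n+2l-2)\,\vartheta^{n+2l-2}(x)}\right),$$ where the $a_{I,l,j}$ are functions of the variable $t$ of class $C^{s,0}([0,T])$ (i.e. $s$ times continuously differentiable on $[0,T]$).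
   Context: $\mathbb{Z}_+=\{0,1,2,\dots\}$. Weighted spaces. Put $w(x)=\sqrt{1+|x|^2}$, $w(x,y)=\max\{w(x),w(y)\}$ for $x,y\in\mathbb{R}^n$. $\|u\|_{C^{0,0}_\delta}=\sup_{x\in\mathbb{R}^n}w^\delta(x)|u(x)|$. Fix a non-empty bounded neighbourhood $U$ of $0$ in $\mathbb{R}^n$; for $0<\lambda\leqslant1$ put $\langle u\rangle_{\lambda,\delta,\mathbb{R}^n}=\sup\{ w^{\delta+\lambda}(x,y)\,|u(x)-u(y)|/|x-y|^\lambda : x,y\in\mathbb{R}^n\setminus U,\ x\neq y,\ |x-y|\leqslant |x|/2\}$. On $\mathbb{R}^n\times[0,T]$: $C^{0,0,\lambda,0}_{\delta,T}$ is the space of continuous functions with finite norm $\|u\|_{C^{0,0,\lambda,0}_{\delta,T}}=\sup_{t\in[0,T]}\|u(\cdot,t)\|_{C^{0,0}_\delta}+\sup_{t\in[0,T]}\langle u(\cdot,t)\rangle_{\lambda,\delta,\mathbb{R}^n}$. $C^{2s,s,\lambda,0}_{\delta,T}$ is the space of functions with continuous derivatives $\partial_t^j\partial_x^\alpha u$, $|\alpha|+2j\leqslant2s$, and finite norm $\sum_{|\alpha|+2j\leqslant2s}\|\partial_t^j\partial_x^\alpha u\|_{C^{0,0,\lambda,0}_{\delta+|\alpha|,T}}$. $C^{2s+k,s,\lambda,0}_{\delta,T}$ is the space of functions with finite norm $\sum_{|\beta|\leqslant k}\|\partial_x^\beta u\|_{C^{2s,s,\lambda,0}_{\delta+|\beta|,T}}$.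 $C^{2s+k,s,\lambda,0}_{\delta,\varLambda^q}$ denotes forms $u=\sum_{|I|=q}u_I(x,t)\,dx_I$ with coefficients in $C^{2s+k,s,\lambda,0}_{\delta,T}$; $t$ is a parameter, and $d$ is the exterior derivative in the variables $x$ only. $Z^{2s+k,s,\lambda,0}_{\delta,\varLambda^q}$ is the set of $f\in C^{2s+k,s,\lambda,0}_{\delta,\varLambda^q}$ with $df=0$ (in the sense of distributions). Potentials. Let $(d^q)^*$ be the formal adjoint of the exterior derivative $d^q$ on $q$-forms on $\mathbb{R}^n$, $\sigma_n$ the area of the unit sphere $\partial B_1$ in $\mathbb{R}^n$, $\star$ the Hodge star, and $e$ the standard fundamental solution of the Laplace operator: $e(x)=\frac{1}{2\pi}\ln|x|$ for $n=2$, $e(x)=\frac{1}{\sigma_n}\frac{|x|^{2-n}}{2-n}$ for $n\geqslant3$. Put $e_q(x,y)=\sum_{|I|=q}e(x-y)(\star dy_I)\,dx_I$ and $\phi_q(x,y)=(d^{n-q-1})^*_y e_q(x,y)$ (the operator acts in $y$). Let $h_l^{(j)}$, $1\leqslant j\leqslant J(l)$, $l\in\mathbb{Z}_+$, be homogeneous harmonic polynomials of degree $l$ on $\mathbb{R}^n$ ($J(l)$ being the dimension of the space of these) whose restrictions form an orthonormal basis of $L^2(\partial B_1)$. Let $\vartheta$ be a fixed smooth function with $\vartheta(x)=|x|$ for $|x|\geqslant 2$ and $0<1/\vartheta(x)\leqslant1$. For $m\in\mathbb{Z}_+$ put $$\phi_{m,q}(x,y)=\phi_q(x,y)+\sum_{|I|=q}\sum_{l=1}^{m+1}\sum_{j=1}^{J(l)}\frac{h_l^{(j)}(x)\,(d^{n-q-1})^*_y\big(h_l^{(j)}(y)(\star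 dy_I)\big)dx_I}{(n+2l-2)\,\vartheta^{n+2l-2}(x)}.$$ For a $(q+1)$-form $f$ depending on the parameter $t$, $(\varPhi_q f)(x,t)=\int_{\mathbb{R}^n}f(y,t)\wedge\phi_q(x,y)$ and $(\varPhi_{m,q}f)(x,t)=\int_{\mathbb{R}^n}f(y,t)\wedge\phi_{m,q}(x,y)$ (integration in $y$). *)

(* Defs.v *)
From HB Require Import structures.
From mathcomp Require Import all_boot all_order all_algebra.
(* The notations of mpoly are incompatible with those of analysis. *)
From mathcomp Require Import -(notations) mpoly.
From mathcomp Require Import all_classical all_reals all_analysis.
From mathcomp Require Import measurable_realfun.

Set Implicit Arguments.
Unset Strict Implicit.
Unset Printing Implicit Defensive.

Import Order.TTheory GRing.Theory Num.Theory numFieldNormedType.Exports.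

Local Open Scope classical_set_scope.
Local Open Scope ring_scope.

Definition rV_display : measure_display.
Proof. exact: default_measure_display. Qed.

(* The sigma-algebra of R^n generated by the coordinates, i.e. the Borel one. *)
Section measurable_rV.
Variables (R : realType) (n : nat).

Let coor : 'I_n -> 'rV[R]_n -> measurableTypeR R := fun i x => x 0 i.

Let rV_set0 : g_sigma_preimage coor set0.
Proof. exact: sigma_algebra0. Qed.

Let rV_setC A : g_sigma_preimage coor A -> g_sigma_preimage coor (~` A).
Proof. exact: sigma_algebraC. Qed.

Let rV_bigcup (F : _^nat) : (forall i, g_sigma_preimage coor (F i)) ->
  g_sigma_preimage coor (\bigcup_i (F i)).
Proof. exact: sigma_algebra_bigcup. Qed.

HB.instance Definition _ := @isMeasurable.Build rV_display 'rV[R]_n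
  (g_sigma_preimage coor) rV_set0 rV_setC rV_bigcup.

Lemma measurable_coord (i : 'I_n) :
  measurable_fun [set: 'rV[R]_n]
    (fun x : 'rV[R]_n => x 0 i : measurableTypeR R).
Proof.
move=> _ Y mY; rewrite setTI; apply: sub_sigma_algebra => /=.
rewrite -bigcup_seq/=; exists i => /=; first by rewrite mem_index_enum.
by exists Y => //; rewrite setTI.
Qed.

Lemma measurable_rowP d (T : measurableType d) (f : T -> 'rV[R]_n) :
  (forall i, measurable_fun [set: T] (fun x => f x 0 i : measurableTypeR R)) ->
  measurable_fun [set: T] f.
Proof.
move=> mf _ A mA; rewrite setTI.
suff : g_sigma_preimage coor `<=` [set B | measurable (f @^-1` B)] by exact.
apply: smallest_sub.
  split => [|B /= mB|F /= mF]; first by rewrite /= preimage_set0.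
    by rewrite setTD preimage_setC; exact: measurableC.
  by rewrite preimage_bigcup; exact: bigcupT_measurable.
rewrite -bigcup_seq; apply: bigcup_sub => i _ B [C mC <-] /=.
by rewrite setTI -comp_preimage -[X in measurable X]setTI; exact: mf.
Qed.

End measurable_rV.

Section lebesgue_rV.
Variable R : realType.

Definition cons_rV n (p : measurableTypeR R * 'rV[R]_n) : 'rV[R]_n.+1 :=
  row_mx (const_mx p.1 : 'rV_1) p.2.

Definition uncons_rV n (x : 'rV[R]_n.+1) : measurableTypeR R * 'rV[R]_n :=
  (x 0 0, \row_i x 0 (lift 0 i)).

Lemma cons_rVK n : cancel (@cons_rV n) (@uncons_rV n).
Proof.
move=> [a x]; rewrite /cons_rV /uncons_rV /=; congr pair.
  transitivity (row_mx (const_mx a : 'rV_1) x 0 (lshift n 0)).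
    by congr (row_mx _ _ _ _); exact/val_inj.
  by rewrite row_mxEl mxE.
apply/rowP => i; rewrite mxE.
transitivity (row_mx (const_mx a : 'rV_1) x 0 (rshift 1 i)).
  by congr (row_mx _ _ _ _); exact/val_inj.
by rewrite row_mxEr.
Qed.

Lemma measurable_cons_rV n : measurable_fun [set: _] (@cons_rV n).
Proof.
apply: measurable_rowP => i.
have [->|[j ->]] : i = lshift n (0 : 'I_1) \/ exists j, i = rshift 1 j.
  by case: (@split_ordP 1 n i) => j ->;
    [left; rewrite (ord1 j)|right; exists j].
- rewrite (_ : (fun _ => _) = fst) //; apply/funext => p.
  transitivity (row_mx (const_mx p.1 : 'rV_1) p.2 0 (lshift n 0)) => //.
  by rewrite row_mxEl mxE.
- rewrite (_ : (fun _ => _) = (fun x : 'rV[R]_n => x 0 j) \o snd); last first.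
    apply/funext => p.
    transitivity (row_mx (const_mx p.1 : 'rV_1) p.2 0 (rshift 1 j)) => //.
    by rewrite row_mxEr.
  by apply: measurableT_comp => //; exact: measurable_coord.
Qed.

Lemma measurable_uncons_rV n : measurable_fun [set: _] (@uncons_rV n).
Proof.
apply/measurable_fun_pairP; split; first exact: measurable_coord.
apply: measurable_rowP => i.
rewrite (_ : (fun _ => _) = fun x : 'rV[R]_n.+1 => x 0 (lift 0 i)).
  exact: measurable_coord.
by apply/funext => x; rewrite mxE.
Qed.

#[local] Hint Extern 0 (measurable_fun _ (@cons_rV _)) =>
  exact: measurable_cons_rV : core.

Section step.
Variables (n : nat) (mu : {sigma_finite_measure set 'rV[R]_n -> \bar R}).

Definition lebesgue_step : set 'rV[R]_n.+1 -> \bar R :=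
  pushforward (@lebesgue_measure R \x mu)%E (@cons_rV n).

Let step0 : lebesgue_step set0 = 0%E. Proof. exact: measure0. Qed.

Let step_ge0 A : (0 <= lebesgue_step A)%E. Proof. exact: measure_ge0. Qed.

Let step_sigma_additive : semi_sigma_additive lebesgue_step.
Proof. exact: measure_semi_sigma_additive. Qed.

HB.instance Definition _ := isMeasure.Build _ _ _ lebesgue_step
  step0 step_ge0 step_sigma_additive.

(* Proved again because inference only finds the sigma-finite structure of a
   product of sub-probabilities. *)
Let prod_sigma_finite : sigma_finite setT (@lebesgue_measure R \x mu)%E.
Proof.
have /sigma_finiteP[F [TF ndF Foo]] := sigma_finiteT (@lebesgue_measure R).
have /sigma_finiteP[G [TG ndG Goo]] := sigma_finiteT mu.
exists (fun k => F k `*` G k).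
  rewrite -setXTT TF TG predeqE => -[x y]; split.
    move=> [/= [k _ Fkx] [l _ Gly]]; exists (maxn k l) => //; split.
    - by move: x Fkx; exact/subsetPset/ndF/leq_maxl.
    - by move: y Gly; exact/subsetPset/ndG/leq_maxr.
  by move=> [k _ []/= ? ?]; split; exists k.
move=> k; have [? ?] := Foo k; have [? ?] := Goo k.
split; first exact: measurableX.
by rewrite product_measure1E// lte_mul_pinfty// ge0_fin_numE.
Qed.

Let step_sigma_finite : sigma_finite setT lebesgue_step.
Proof.
have [F TF Foo] := prod_sigma_finite.
exists (fun k => @uncons_rV n @^-1` F k).
  by rewrite -preimage_bigcup -TF preimage_setT.
move=> k; have [mF Fk] := Foo k; split.
  by rewrite -[X in measurable X]setTI; exact: measurable_uncons_rV.
rewrite /lebesgue_step /pushforward -comp_preimage.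
by rewrite (_ : _ \o _ = id) ?preimage_id//; apply/funext => p; exact: cons_rVK.
Qed.

HB.instance Definition _ := Measure_isSigmaFinite.Build _ _ _ lebesgue_step
  step_sigma_finite.

End step.

(* Lebesgue measure on R^n, as an n-fold product measure. *)
Fixpoint lebesgue_rV n : {sigma_finite_measure set 'rV[R]_n -> \bar R} :=
  match n with
  | 0 => \d_(0 : 'rV[R]_0)
  | n'.+1 => lebesgue_step (lebesgue_rV n')
  end.

End lebesgue_rV.

Section euclidean.
Variables (R : realType) (n : nat).
Implicit Types x y : 'rV[R]_n.

(* Euclidean norm; the norm `|x| of 'rV[R]_n is the sup norm. *)
Definition enorm x : R := Num.sqrt (\sum_i x 0 i ^+ 2).

Lemma measurable_enorm :
  measurable_fun [set: 'rV[R]_n] (enorm : _ -> measurableTypeR R).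
Proof.
apply: (@measurableT_comp _ _ _ _ _ _
  (Num.sqrt : measurableTypeR R -> measurableTypeR R)).
  by apply: continuous_measurable_fun; exact: sqrt_continuous.
by apply: measurable_sum => i; apply: measurable_funX; exact: measurable_coord.
Qed.

Let dir x : 'rV[R]_n := (enorm x)^-1 *: x.

Let measurable_dir : measurable_fun [set: 'rV[R]_n] dir.
Proof.
apply: measurable_rowP => i.
rewrite (_ : (fun _ => _) = fun x : 'rV[R]_n => powR (enorm x) (-1) * x 0 i).
  apply: measurable_funM; last exact: measurable_coord.
  apply: (@measurableT_comp _ _ _ _ _ _
    (fun r => powR r (-1) : measurableTypeR R)); last exact: measurable_enorm.
  exact: measurable_powR.
by apply/funext => x; rewrite mxE powR_inv1// sqrtr_ge0.
Qed.

Let cone := [set x | 0 < enorm x <= 1].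

Let measurable_cone : measurable cone.
Proof.
rewrite (_ : cone = (enorm : _ -> measurableTypeR R) @^-1` `]0, 1]).
  by rewrite -[X in measurable X]setTI; exact: measurable_enorm.
by apply/seteqP; split => x; rewrite /= in_itv.
Qed.

Definition cone_over (A : set 'rV[R]_n) : set 'rV[R]_n :=
  [set x | 0 < enorm x <= 1 /\ A ((enorm x)^-1 *: x)].

(* Surface measure of the unit sphere S, as a measure on R^n carried by S:
   the area of A is n times the volume of {r w | w in A and S, 0 < r <= 1}. *)
Definition sphere_measure (A : set 'rV[R]_n) : \bar R :=
  (n%:R%:E * lebesgue_rV R n (cone_over A))%E.

Let restr := mrestr (lebesgue_rV R n) measurable_cone.

Let push :=
  measure_function_pushforward__canonical__measure_function_Measure
    restr measurable_dir.

Let sphere_measureE A : sphere_measure A = mscale n%:R%:nng push A.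
Proof.
rewrite /sphere_measure /mscale /pushforward /restr /mrestr /=.
by congr (_ * lebesgue_rV R n _)%E; rewrite setIC.
Qed.

Let sphere0 : sphere_measure set0 = 0%E.
Proof. by rewrite sphere_measureE; exact: measure0. Qed.

Let sphere_ge0 A : (0 <= sphere_measure A)%E.
Proof. by rewrite sphere_measureE; exact: measure_ge0. Qed.

Let sphere_sigma_additive : semi_sigma_additive sphere_measure.
Proof.
rewrite (funext sphere_measureE); exact: measure_semi_sigma_additive.
Qed.

HB.instance Definition _ := isMeasure.Build _ _ _ sphere_measure
  sphere0 sphere_ge0 sphere_sigma_additive.

Definition sphere_area : R := fine (sphere_measure [set: 'rV[R]_n]).

End euclidean.

Section derivatives.
Variables (R : realType) (n : nat).

Definition pderiv (i : 'I_n) (g : 'rV[R]_n -> R) : 'rV[R]_n -> R :=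
  fun x => 'D_(delta_mx 0 i) g x.

Definition pderivs (r : seq 'I_n) (g : 'rV[R]_n -> R) : 'rV[R]_n -> R :=
  foldr pderiv g r.

Definition smooth (g : 'rV[R]_n -> R) : Prop :=
  forall r, continuous (pderivs r g) /\
    forall i x, derivable (pderivs r g) x (delta_mx 0 i).

Definition test_function (g : 'rV[R]_n -> R) : Prop :=
  smooth g /\ compact (closure [set x | g x != 0]).

(* Derivatives in the interval [0, T]: one-sided at 0 and at T. *)
Definition quot_at (T : R) (g : R -> R) (t : R) : set_system R :=
  (fun e => e^-1 * (g (t + e) - g t)) @
    within (fun e => 0 <= t + e <= T) 0^'.

Definition tderivable T g t : Prop := cvg (quot_at T g t).

Definition tderiv T g : R -> R := fun t => lim (quot_at T g t).

Definition tderivs T j g : R -> R := iter j (tderiv T) g.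

Definition Cn_on (T : R) (s : nat) (a : R -> R) : Prop :=
  (forall j, (j <= s)%N -> {within `[0, T], continuous (tderivs T j a)}) /\
  (forall j t, (j < s)%N -> 0 <= t <= T -> tderivable T (tderivs T j a) t).

Implicit Types u : 'rV[R]_n -> R -> R.

Definition dx (r : seq 'I_n) u : 'rV[R]_n -> R -> R :=
  fun x t => pderivs r (u ^~ t) x.

Definition dt (T : R) (j : nat) u : 'rV[R]_n -> R -> R :=
  fun x => tderivs T j (u x).

Definition dx_exists (T : R) (r : seq 'I_n) (i : 'I_n) u : Prop :=
  forall x t, 0 <= t <= T -> derivable (dx r u ^~ t) x (delta_mx 0 i).

(* The multi-index al, as a list of indices in increasing order. *)
Definition multi_seq k (al : {ffun 'I_n -> 'I_k}) : seq 'I_n :=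
  flatten [seq nseq (al i) i | i <- enum 'I_n].

Definition continuous_cyl (T : R) u : Prop :=
  {within [set: 'rV[R]_n] `*` `[0, T], continuous (fun p => u p.1 p.2)}.

(* Continuous derivatives d_t^j d_x^alpha u for |alpha| + 2j <= 2s, the
   derivatives in x being taken in any order. *)
Definition regular (T : R) (s : nat) u : Prop :=
  [/\ forall r i, (size r < 2 * s)%N -> dx_exists T r i u,
      forall r j x t, (size r + 2 * j.+1 <= 2 * s)%N -> 0 <= t <= T ->
        tderivable T (dt T j (dx r u) x) t &
      forall r j, (size r + 2 * j <= 2 * s)%N ->
        continuous_cyl T (dt T j (dx r u))].

Definition regular_k (T : R) (s k : nat) u : Prop :=
  (forall r i, (size r < k)%N -> dx_exists T r i u) /\
  (forall r, (size r <= k)%N -> regular T s (dx r u)).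

End derivatives.

Section weighted_spaces.
Variables (R : realType) (n : nat) (lam T : R) (U : set 'rV[R]_n).
Implicit Types (x y : 'rV[R]_n) (v : 'rV[R]_n -> R) (u : 'rV[R]_n -> R -> R).

Definition weight x : R := Num.sqrt (1 + enorm x ^+ 2).

Definition weight2 x y : R := Num.max (weight x) (weight y).

Definition norm00 (delta : R) v : \bar R :=
  ereal_sup [set (weight x `^ delta * `|v x|)%:E | x in [set: 'rV[R]_n]].

Definition hoelder_pair (p : 'rV[R]_n * 'rV[R]_n) : Prop :=
  [/\ ~ U p.1, ~ U p.2, p.1 != p.2 & enorm (p.1 - p.2) <= enorm p.1 / 2].

Definition hoelder00 (delta : R) v : \bar R :=
  ereal_sup [set (weight2 p.1 p.2 `^ (delta + lam) * `|v p.1 - v p.2|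
                  / enorm (p.1 - p.2) `^ lam)%:E | p in hoelder_pair].

Definition norm0 (delta : R) u : \bar R :=
  (ereal_sup [set norm00 delta (u ^~ t) | t in `[0%R, T]] +
   ereal_sup [set hoelder00 delta (u ^~ t) | t in `[0%R, T]])%E.

Definition mdeg_ffun k (al : {ffun 'I_n -> 'I_k}) : nat := (\sum_i al i)%N.

Definition norm2s (s : nat) (delta : R) u : \bar R :=
  (\sum_(j < s.+1)
   \sum_(al : {ffun 'I_n -> 'I_(2 * s).+1} | (mdeg_ffun al + 2 * j <= 2 * s)%N)
     norm0 (delta + (mdeg_ffun al)%:R) (dt T j (dx (multi_seq al) u)))%E.

Definition norm2sk (s k : nat) (delta : R) u : \bar R :=
  (\sum_(be : {ffun 'I_n -> 'I_k.+1} | (mdeg_ffun be <= k)%N)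
     norm2s s (delta + (mdeg_ffun be)%:R) (dx (multi_seq be) u))%E.

(* The space C^{2s+k,s,lambda,0}_{delta,T}. *)
Definition space2sk (s k : nat) (delta : R) u : Prop :=
  regular_k T s k u /\ (norm2sk s k delta u < +oo)%E.

End weighted_spaces.

Section forms.
Variables (R : realType) (n : nat).

(* a : extform is sum_I (a I) dx_I, where dx_I is the wedge product of the dx_i,
   i in I, in increasing order. *)
Definition extform := {set 'I_n} -> R.
Implicit Types (a b : extform) (I J K : {set 'I_n}) (v : 'rV[R]_n -> extform).

Definition form_degree q a : Prop := forall I, #|I| != q -> a I = 0.

(* dx_I /\ dx_J = wsign I J dx_{I u J} for disjoint I, J. *)
Definition wsign I J : R :=
  (-1) ^+ #|[set p : 'I_n * 'I_n |
              [&& p.1 \in I, p.2 \in J & (p.2 < p.1)%N]]%SET|.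

Definition wedge a b : extform :=
  fun K => \sum_(I : {set 'I_n} | I \subset K)
             wsign I (K :\: I) * a I * b (K :\: I).

Definition dform I : extform := fun K => (K == I)%:R.

(* star dx_I = wsign I (~: I) dx_{~: I}, so that dx_I /\ star dx_I is the
   volume form. *)
Definition hodge a : extform := fun K => wsign (~: K) K * a (~: K).

Definition ext_d v : 'rV[R]_n -> extform :=
  fun x K => \sum_(i in K)
    wsign [set i] (K :\ i) * pderiv i (fun z => v z (K :\ i)) x.

(* Formal adjoint of d: the transpose of the matrix of differential operators
   above, with each derivative replaced by its opposite. *)
Definition ext_d_adj v : 'rV[R]_n -> extform :=
  fun x I => - \sum_(i | i \notin I)
    wsign [set i] I * pderiv i (fun z => v z (i |: I)) x.

(* dv = 0 in the sense of distributions, component by component. *)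
Definition weakly_closed v : Prop :=
  forall (K : {set 'I_n}) (psi : 'rV[R]_n -> R), test_function psi ->
  \int[lebesgue_rV R n]_x
    (\sum_(i in K) wsign [set i] (K :\ i) * v x (K :\ i) * pderiv i psi x) = 0.

(* Forms in x depending on the parameter t. *)
Definition tform := 'rV[R]_n -> R -> extform.
Implicit Types f : tform.

Definition Zspace (lam T : R) (U : set 'rV[R]_n) (s k : nat) (delta : R)
    (q : nat) f : Prop :=
  [/\ forall x t, 0 <= t <= T -> form_degree q (f x t),
      forall I, #|I| = q ->
        space2sk lam T U s k delta (fun x t => f x t I) &
      forall t, 0 <= t <= T -> weakly_closed (fun x => f x t)].

(* A double form sum_I (b x y I) dx_I, with b x y I a form in y. *)
Definition dblform := 'rV[R]_n -> 'rV[R]_n -> {set 'I_n} -> extform.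

Definition potential (b : dblform) f : tform :=
  fun x t I => \int[lebesgue_rV R n]_y wedge (f y t) (b x y I) [set: 'I_n]%SET.

(* The fundamental solution e of the Laplace operator. *)
Definition fundsol (x : 'rV[R]_n) : R :=
  if n == 2%N then ln (enorm x) / (2 * pi)
  else (enorm x ^+ (n - 2))^-1 / (sphere_area R n * (2 - n%:R)).

(* phi_q(x, y); its value at y = x, where e is singular, does not matter for
   the integrals in y. *)
Definition phi_ker (q : nat) : dblform := fun x y I =>
  if #|I| == q
  then ext_d_adj (fun z K => fundsol (x - z) * hodge (dform I) K) y
  else fun=> 0.

Variables (J : nat -> nat) (h : nat -> nat -> mpoly n R).
Variable theta : 'rV[R]_n -> R.

Definition hfun l j (x : 'rV[R]_n) : R := meval (fun i => x 0 i) (h l j).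

Definition hterm l j (x : 'rV[R]_n) : R :=
  hfun l j x / ((n + 2 * l - 2)%:R * theta x ^+ (n + 2 * l - 2)).

Definition phim_ker (m q : nat) : dblform := fun x y I K =>
  phi_ker q x y I K +
  if #|I| == q then
    \sum_(1 <= l < m.+2) \sum_(j < J l)
      hterm l j x * ext_d_adj (fun z L => hfun l j z * hodge (dform I) L) y K
  else 0.

(* The operator d (Phi_q - Phi_{m,q}). *)
Definition d_Phi_diff (m q : nat) f : tform := fun x t =>
  ext_d (fun z I => potential (phi_ker q) f z t I
                   - potential (phim_ker m q) f z t I) x.

Definition multipole (m q : nat) (a : {set 'I_n} -> nat -> nat -> R -> R) :
    tform := fun x t I =>
  if #|I| == q then
    \sum_(1 <= l < m.+2) \sum_(j < J l) a I l j t * hterm l j x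
  else 0.

End forms.

Section harmonics.
Variables (R : realType) (n : nat).

Definition harmonic_homog (l : nat) (p : mpoly n R) : Prop :=
  p \is ishomog1 l mdeg /\ \sum_i mderiv i (mderiv i p) = 0.

(* The subspace P of V has a basis with d elements. *)
Definition has_dim (V : lmodType R) (P : V -> Prop) (d : nat) : Prop :=
  exists b : 'I_d -> V, (forall i, P (b i)) /\
    forall v, P v -> exists! c : 'rV[R]_d, v = \sum_i c 0 i *: b i.

Definition approx_error (J : nat -> nat) (h : nat -> nat -> mpoly n R)
    (g : 'rV[R]_n -> R) (L : nat) (c : nat -> nat -> R) : 'rV[R]_n -> R :=
  fun x => g x - \sum_(l < L) \sum_(j < J l) c l j * hfun h l j x.

(* Total in L^2 of the sphere: finite linear combinations are dense. *)
Definition sphere_total (J : nat -> nat) (h : nat -> nat -> mpoly n R) : Prop :=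
  forall (g : 'rV[R]_n -> R) (e : R), measurable_fun [set: 'rV[R]_n] g ->
  (Lnorm (@sphere_measure R n) 2%:E (EFin \o g) < +oo)%E -> 0 < e ->
  exists (L : nat) (c : nat -> nat -> R),
  (Lnorm (@sphere_measure R n) 2%:E (EFin \o approx_error J h g L c) < e%:E)%E.

(* The h l j, j < J l (counted from 0), are harmonic and homogeneous of degree
   l, J l is the dimension of the space of these, and the restrictions to the
   unit sphere S of all the h l j form an orthonormal basis of L^2(S). *)
Definition harmonic_basis (J : nat -> nat) (h : nat -> nat -> mpoly n R) :
    Prop :=
  [/\ forall l, has_dim (harmonic_homog l) (J l),
      forall l j, (j < J l)%N -> harmonic_homog l (h l j),
      forall l j l' j', (j < J l)%N -> (j' < J l')%N ->
        \int[@sphere_measure R n]_x (hfun h l j x * hfun h l' j' x) =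
          ((l == l') && (j == j'))%:R &
      sphere_total J h].

End harmonics.

(* Main.v *)
Require Import Defs.
From mathcomp Require Import all_boot all_order all_algebra.
From mathcomp Require Import -(notations) mpoly.
From mathcomp Require Import all_classical all_reals all_analysis.
From mathcomp Require Import measurable_realfun ring lra.

(** The kernels of [Phi] and [Phi_m] differ by a finite sum of products
    [hterm l j x * psi_(I,l,j)(y)], where [psi_(I,l,j)] has polynomial
    coefficients of degree [l - 1 <= m].  A form in the space of weight
    [delta + 1 > n + m] can be integrated against them, so [(Phi - Phi_m) f] is
    the multipole sum whose coefficients are the moments
    [a_(I,l,j)(t) = - \int f(y,t) /\ psi_(I,l,j)(y)].  The derivatives
    [d_t^j f], [j <= s], are continuous and decay at the same rate, uniformly in
    [t], hence these moments can be differentiated [s] times under the integral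
    sign.  The integral defining [Phi f] itself converges absolutely, because
    the kernel is [O(|x - y|^(1-n))]. *)

(** Lebesgue measure on ['rV[R]_n] is an iterated product, so the volumes at hand are those of
    cubes. The two estimates usually read off polar coordinates, decay of order above $n$ at
    infinity and the singularity $|x-y|^{1-n}$, are therefore obtained by summing over dyadic cubes.
    Integrals of non-integrable functions and missing limits have default values, so each splitting
    of an integral must come with integrability, and each time derivative with the existence of its
    limit. Time derivatives are one-sided at $0$ and $T$ and the data are controlled only on
    $[0,T]$; hence limits in $t$ run along filters restricted to that interval. The identity between
    $(\Phi-\Phi_m)f$ and the multipole sum is proved pointwise in $x$, before $d$ is applied, so no
    derivative in $x$ has to pass under an integral. *)

Set Implicit Arguments.
Unset Strict Implicit.
Unset Printing Implicit Defensive.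

Import Order.TTheory GRing.Theory Num.Theory numFieldNormedType.Exports.

Local Open Scope classical_set_scope.
Local Open Scope ring_scope.

(** * Integrability by domination on cubes *)

Section cubes.
Variable R : realType.

Definition cube n (p : 'rV[R]_n) (r : R) : set 'rV[R]_n :=
  [set y | forall i, `|y 0 i - p 0 i| <= r].

Lemma measurable_cube n (p : 'rV[R]_n) r : measurable (cube p r).
Proof.
rewrite (_ : cube p r = \bigcap_(i in [set: 'I_n])
    ((fun y : 'rV[R]_n => y 0 i : measurableTypeR R) @^-1`
      `[p 0 i - r, p 0 i + r])).
  apply: fin_bigcap_measurable; first exact: finite_finset.
  move=> i _; rewrite -[X in measurable X]setTI.
  by apply: measurable_coord => //; exact: measurable_itv.
apply/seteqP; split => y /= yr i.
  by move=> _; rewrite /= in_itv /= -ler_distlC distrC.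
by have := yr i I; rewrite /= in_itv /= -ler_distlC distrC.
Qed.

Lemma lebesgue_cube n (p : 'rV[R]_n) r : 0 <= r ->
  lebesgue_rV R n (cube p r) = ((2 * r) ^+ n)%:E.
Proof.
move=> r0; elim: n p => [|n IHn] p.
  by rewrite expr0 /= diracE mem_set// => -[i i0]; exfalso; rewrite ltn0 in i0.
rewrite /= /lebesgue_step /pushforward.
pose p' : 'rV[R]_n := \row_i p 0 (lift 0 i).
rewrite [X in (_ \x _)%E X](_ : _ = `[p 0 0 - r, p 0 0 + r]%classic `*` cube p' r).
  rewrite product_measure1E//; last exact: measurable_cube.
  rewrite IHn.
  rewrite exprS EFinM; congr (_ * _)%E.
  transitivity (lebesgue_measure `[p 0 0 - r, p 0 0 + r]%classic) => //.
  rewrite lebesgue_measure_itv/= lte_fin.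
  case: ltP => h; first by rewrite -EFinD; congr EFin; ring.
  by have -> : r = 0 by [lra]; rewrite mulr0.
apply/seteqP; split => -[a y] /=.
  move=> h; split.
    have := h 0; rewrite /= in_itv /= -ler_distlC distrC.
    by rewrite -[cons_rV _ 0 0]/((uncons_rV (cons_rV (a, y))).1) cons_rVK.
  move=> i; have := h (lift 0 i).
  have {2}<- : (uncons_rV (cons_rV (a, y))).2 = y by rewrite cons_rVK.
  by rewrite !mxE.
move=> [ha hy] i.
have [j ->|->] := unliftP 0 i.
  have := hy j; have {1}<- : (uncons_rV (cons_rV (a, y))).2 = y by rewrite cons_rVK.
  by rewrite !mxE.
move: ha; rewrite /= in_itv /= -ler_distlC distrC.
by rewrite -[cons_rV _ 0 0]/((uncons_rV (cons_rV (a, y))).1) cons_rVK.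
Qed.

(* F is dominated by sum_k c_k 1_(cube p r_k), whose integral is bounded by a
   geometric series.  Radii growing with k handle decay at infinity, shrinking
   radii an isolated singularity. *)
Lemma integrable_cubes n (F : 'rV[R]_n -> R) (p : 'rV[R]_n) (r c : nat -> R)
    (C rho : R) :
  measurable_fun [set: 'rV[R]_n] F ->
  (forall k, 0 <= r k) -> (forall k, 0 <= c k) -> 0 <= rho < 1 ->
  (forall k, c k * (2 * r k) ^+ n <= C * rho ^+ k) ->
  (forall y, F y != 0 -> exists2 k, cube p (r k) y & `|F y| <= c k) ->
  (lebesgue_rV R n).-integrable [set: 'rV[R]_n] (EFin \o F).
Proof.
move=> mF r0 c0 /andP[rho0 rho1] cr Fc.
have mc k : measurable_fun [set: 'rV[R]_n]
    (fun y => (c k * \1_(cube p (r k)) y)%:E).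
  apply/measurable_EFinP; apply: measurable_funM => //.
  by apply: measurable_indic; exact: measurable_cube.
have cI0 k y : (0 <= (c k * \1_(cube p (r k)) y)%:E)%E.
  by rewrite lee_fin mulr_ge0.
apply/integrableP; split; first exact/measurable_EFinP.
apply: (@le_lt_trans _ _
  (\int[lebesgue_rV R n]_y
     \sum_(k <oo) (c k * \1_(cube p (r k)) y)%:E)%E).
  apply: ge0_le_integral => //.
  - by apply: measurableT_comp => //; exact/measurable_EFinP.
  - by apply: ge0_emeasurable_sum => // k y _ _; exact: cI0.
  move=> y _ /=; have [->|Fy] := eqVneq (F y) 0.
    by rewrite normr0; apply: nneseries_ge0.
  have [k yk Fk] := Fc y Fy.
  apply: (@le_trans _ _ (\sum_(0 <= i < k.+1) (c i * \1_(cube p (r i)) y)%:E)%E).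
    rewrite big_nat_recr//= indicE mem_set// mulr1.
    apply: (@le_trans _ _ (c k)%:E); first by rewrite lee_fin.
    by rewrite leeDr// sume_ge0.
  by apply: nneseries_lim_ge => i _ _; exact: cI0.
rewrite integral_nneseries//.
have intc k : (\int[lebesgue_rV R n]_y (c k * \1_(cube p (r k)) y)%:E =
    (c k * (2 * r k) ^+ n)%:E)%E.
  under eq_integral do rewrite EFinM.
  rewrite ge0_integralZl//; last first.
  - by rewrite lee_fin.
  - by apply/measurable_EFinP; apply: measurable_indic; exact: measurable_cube.
  rewrite integral_indic//; last exact: measurable_cube.
  by rewrite EFinM setIT; congr (_ * _)%E; exact: lebesgue_cube.
under eq_eseriesr do rewrite intc.
apply: (@le_lt_trans _ _ (\sum_(k <oo) (C * rho ^+ k)%:E)%E).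
  apply: lee_nneseries => [k _ _|k _]; last by rewrite lee_fin cr.
  by rewrite lee_fin mulr_ge0// exprn_ge0// mulr_ge0.
have h : ((fun N => \sum_(0 <= k < N) (C * rho ^+ k)%:E)%E @ \oo --> (C * (1 - rho)^-1)%:E).
  apply: cvg_EFin; first by apply: nearW => //= N; rewrite sumEFin.
  rewrite [X in X @ _ --> _](_ : _ = series (geometric C rho)).
    by apply: cvg_geometric_series; rewrite ger0_norm.
  by apply/funext => N; rewrite /= sumEFin.
by rewrite (cvg_lim _ h)// ltry.
Qed.

End cubes.

(** * Borel sets and the coordinate sigma-algebra *)

Section borel.
Variables (R : realType) (n : nat).

(** The sigma-algebra comes from the coordinates and the topology from the sup norm; they are linked
    by countably many cubes with rational centres and radii $1/(k+1)$. A cube not contained in [O]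
    is replaced by the empty set, which keeps the index set countable. *)
Lemma open_measurable_rV (O : set 'rV[R]_n) : open O -> measurable O.
Proof.
move=> oO.
pose F (u : 'rV[rat]_n * nat) : set 'rV[R]_n :=
  let B := cube (map_mx ratr u.1) u.2.+1%:R^-1 in
  if pselect (B `<=` O) then B else set0.
rewrite (_ : O = \bigcup_u F u).
  apply: countable_bigcupT_measurable => [|u]; first exact: countableP.
  rewrite /F.
  by case: pselect => h; [exact: measurable_cube|exact: measurable0].
apply/seteqP; split => [x Ox|x [u _]]; last first.
  by by rewrite /F; case: pselect => //= h; exact: h.
have /nbhs_ballP[e /= e0 xeO] : nbhs x O by exact: open_nbhs_nbhs.
(* Half of [e] for the distance from [x] to the rational centre, half for the radius of the cube. *)
have [k ke] : exists k : nat, k.+1%:R^-1 < e / 2.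
  exists (Num.truncn (e / 2)^-1).
  by rewrite invf_plt ?posrE ?divr_gt0// truncnS_gt.
have k0 : 0 < k.+1%:R^-1 :> R by rewrite invr_gt0.
have /choice[q qx] : forall i : 'I_n, exists q : rat, `|x 0 i - ratr q| <= k.+1%:R^-1.
  move=> i; have /rat_in_itvoo[q] : x 0 i - k.+1%:R^-1 < x 0 i + k.+1%:R^-1.
    by rewrite ltrBlDr -addrA ltrDl addr_gt0.
  rewrite in_itv/= => /andP[q1 q2]; exists q.
  by rewrite ler_distlC; apply/andP; split; exact: ltW.
exists (\row_i q i, k) => //; rewrite /F /=.
case: pselect => /= [h i|[]]; first by rewrite !mxE.
move=> y yq; apply: xeO; split => // i j; rewrite ord1.
rewrite /ball/= -(subrK (ratr (q j)) (x 0 j)) -addrA.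
rewrite (le_lt_trans (ler_normD _ _))// (splitr e) ltrD//.
  exact: le_lt_trans (qx j) ke.
by have := yq j; rewrite !mxE distrC => /le_lt_trans; apply.
Qed.

Lemma continuous_measurable_rV (f : 'rV[R]_n -> R) :
  continuous f -> measurable_fun [set: 'rV[R]_n] f.
Proof.
move=> /continuousP cf; apply: (measurability _ (RGenOpens.measurableE R)).
move=> _ [_ [a [b ->] <-]]; rewrite setTI; apply: open_measurable_rV.
exact/cf/interval_open.
Qed.

Lemma measurable_set1_rV (x : 'rV[R]_n) : measurable [set x].
Proof.
rewrite (_ : [set x] = cube x 0); first exact: measurable_cube.
apply/seteqP; split => y /=; first by move=> -> i; rewrite subrr normr0.
move=> h; apply/rowP => i; apply/eqP; rewrite -subr_eq0 -normr_le0; exact: h.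
Qed.

End borel.

(** * Integrability from decay at infinity and from a weak singularity *)

Section decay.
Variables (R : realType) (n : nat).
Implicit Types x y : 'rV[R]_n.

Lemma coord_le_enorm y i : `|y 0 i| <= enorm y.
Proof.
rewrite -sqrtr_sqr; apply: ler_wsqrtr; rewrite (bigD1 i)//= lerDl.
by apply: sumr_ge0 => j _; exact: sqr_ge0.
Qed.

Lemma enorm_ge0 y : 0 <= enorm y. Proof. exact: sqrtr_ge0. Qed.

Lemma enorm_gt0 y : (0 < enorm y) = (y != 0).
Proof.
rewrite lt_neqAle enorm_ge0 andbT eq_sym; congr (~~ _).
apply/eqP/eqP => [y0|->].
  apply/rowP => i; rewrite mxE; apply/eqP; rewrite -normr_le0 -y0.
  exact: coord_le_enorm.
by rewrite /enorm big1 ?sqrtr0// => i _; rewrite mxE expr0n.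
Qed.

Lemma weight_ge1 y : 1 <= weight y.
Proof. by rewrite -[leLHS]sqrtr1 ler_wsqrtr// lerDl sqr_ge0. Qed.

Lemma weight_gt0 y : 0 < weight y.
Proof. exact: lt_le_trans (weight_ge1 y). Qed.

Lemma enorm_le_weight y : enorm y <= weight y.
Proof.
by rewrite -[leLHS]ger0_norm ?enorm_ge0// -sqrtr_sqr ler_wsqrtr// lerDr.
Qed.

Lemma measurable_weight_powR a :
  measurable_fun [set: 'rV[R]_n] (fun y => weight y `^ a).
Proof.
apply: (@measurableT_comp _ _ _ _ _ _
    (fun r => powR r a : measurableTypeR R)); first exact: measurable_powR.
apply: (@measurableT_comp _ _ _ _ _ _
  (Num.sqrt : measurableTypeR R -> measurableTypeR R)).
  by apply: continuous_measurable_fun; exact: sqrt_continuous.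
apply: measurable_funD => //; apply: measurable_funX; exact: measurable_enorm.
Qed.

Lemma powRN_le (a b c : R) : 0 < b -> b <= c -> 0 <= a -> c `^ (- a) <= b `^ (- a).
Proof.
move=> b0 bc a0; have c0 := lt_le_trans b0 bc.
by rewrite !powRN lef_pV2 ?posrE ?powR_gt0// ge0_ler_powR// nnegrE ltW.
Qed.

Lemma exp2_gt (a : R) : exists k, a < 2 ^+ k.
Proof.
exists (Num.truncn a).+1; apply: lt_trans (truncnS_gt a) _.
by rewrite -natrX ltr_nat ltn_expl.
Qed.

(** On the $k$-th dyadic shell $|F|$ is of order $2^{-ak}$ and the cube has volume of order
    $2^{nk}$, which gives a geometric series of ratio $2^{n-a}<1$. *)
Lemma integrable_decay (F : 'rV[R]_n -> R) C a :
  measurable_fun [set: 'rV[R]_n] F -> 0 <= C -> n%:R < a ->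
  (forall y, `|F y| <= C * weight y `^ (- a)) ->
  (lebesgue_rV R n).-integrable [set: 'rV[R]_n] (EFin \o F).
Proof.
move=> mF C0 na FC; have a0 : 0 <= a by apply: le_trans (ltW na); rewrite ler0n.
apply: (@integrable_cubes _ _ _ 0 (fun k => 2 ^+ k)
  (fun k => C * 2 `^ a * (2 `^ (- a)) ^+ k) (C * 2 `^ a * 2 ^+ n)
  (2 `^ (- a) * 2 ^+ n)) => //.
- by move=> k; rewrite !mulr_ge0 ?exprn_ge0 ?powR_ge0.
- rewrite mulr_ge0 ?powR_ge0 ?exprn_ge0//= powRN mulrC ltr_pdivrMr ?powR_gt0//.
  rewrite mul1r -powR_mulrn// /powR ifF ?ifF ?pnatr_eq0//.
  by rewrite ltr_expR ltr_pM2r// ln_gt0// ltr1n.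
- move=> k; rewrite !exprMn -!exprM (mulnC k n) le_eqVlt; apply/orP; left; apply/eqP.
  by rewrite exprM; ring.
move=> y _.
have ex : exists k, [forall i, `|y 0 i| <= 2 ^+ k].
  have [k yk] := exp2_gt (enorm y); exists k; apply/forallP => i.
  exact: le_trans (coord_le_enorm y i) (ltW yk).
(* For positive [k], minimality yields a coordinate exceeding $2^{k-1}$, hence a lower bound for the
   weight. The factor $2^a$ in the constants pays for this loss of one index; for [k] zero, the
   weight being at least 1 is enough. *)
case: (ex_minnP ex) => k /forallP yk kmin; exists k.
  by move=> i; rewrite mxE subr0.
apply: le_trans (FC y) _; rewrite -mulrA ler_wpM2l//.
case: k yk kmin => [|k] yk kmin.
  rewrite expr0 mulr1; apply: (@le_trans _ _ 1).
    by have <- : 1 `^ (- a) = 1 :> R; [rewrite powR1|rewrite powRN_le// weight_ge1].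
  by rewrite -[leLHS](powRr0 2) ler_powR// ler1n.
have /forallPn[i] : ~~ [forall i, `|y 0 i| <= 2 ^+ k].
  by apply/negP => /kmin; rewrite ltnn.
rewrite -ltNge => yi.
apply: (@le_trans _ _ ((2 ^+ k) `^ (- a))).
  apply: powRN_le => //.
  apply: ltW; apply: lt_le_trans yi _.
  exact: le_trans (coord_le_enorm _ _) (enorm_le_weight _).
have e1 : 2 `^ a * 2 `^ (- a) = 1 :> R by rewrite powRN mulfV// gt_eqF// powR_gt0.
by rewrite exprS mulrA e1 mul1r -powR_mulrn ?powR_ge0// -powR_mulrn// powRAC.
Qed.

(* The value of F at the singularity x is arbitrary; it is absorbed in the
   constant C + |F x|. *)
Lemma integrable_singular (F : 'rV[R]_n -> R) x C : (0 < n)%N ->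
  measurable_fun [set: 'rV[R]_n] F -> 0 <= C ->
  (forall y, y != x -> `|F y| <= C / enorm (x - y) ^+ n.-1) ->
  (forall y, F y != 0 -> enorm (x - y) <= 1) ->
  (lebesgue_rV R n).-integrable [set: 'rV[R]_n] (EFin \o F).
Proof.
move=> n0 mF C0 FC F1; have C'0 : 0 <= C + `|F x| by rewrite addr_ge0.
apply: (@integrable_cubes _ _ _ x (fun k => 2 ^- k)
  (fun k => (C + `|F x|) * (2 ^+ n.-1) ^+ k.+1)
  ((C + `|F x|) * 2 ^+ n.-1 * 2 ^+ n) 2^-1) => //.
- by move=> k; rewrite mulr_ge0// !exprn_ge0.
- by rewrite invr_ge0 ler0n/= invf_lt1// ltr1n.
(* The singularity has order $n-1$ against a volume of order $n$: one factor $1/2$ per step is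
   left. *)
- move=> k; have key : (2 ^+ n.-1) ^+ k * (2 ^- k) ^+ n = 2^-1 ^+ k :> R.
    rewrite -{2}(prednK n0) exprS mulrCA -exprVn -!exprM (mulnC n.-1) -exprMn.
    by rewrite divff ?pnatr_eq0// expr1n mulr1.
  by rewrite exprMn [(2 ^+ n.-1) ^+ _]exprS -key le_eqVlt; apply/orP; left; apply/eqP; ring.
move=> y Fy; have [->|yx] := eqVneq y x.
  exists 0%N; first by move=> i; rewrite subrr normr0 expr0 invr1.
  rewrite expr1; apply: (@le_trans _ _ (C + `|F x|)); first by rewrite lerDr.
  by rewrite ler_peMr// exprn_ege1// ler1n.
have d0 : 0 < enorm (x - y) by rewrite enorm_gt0 subr_eq0 eq_sym.
(* The least such [k] places $|x-y|$ between $2^{-k-1}$ and $2^{-k}$; for [k] zero the upper bound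
   is the support condition instead. *)
have ex : exists k, (enorm (x - y))^-1 <= 2 ^+ k.+1.
  have [k yk] := exp2_gt (enorm (x - y))^-1; exists k.
  by apply: le_trans (ltW yk) _; rewrite ler_eXn2l ?ltr1n.
case: (ex_minnP ex) => k yk kmin; exists k.
  move=> i; apply: (@le_trans _ _ (enorm (x - y))).
    by have := coord_le_enorm (x - y) i; rewrite !mxE distrC.
  case: k yk kmin => [|k] yk kmin; first by rewrite expr0 invr1 F1.
  rewrite -[leLHS]invrK lef_pV2 ?posrE ?invr_gt0 ?exprn_gt0//.
  by rewrite leNgt; apply/negP => /ltW/kmin; rewrite ltnn.
apply: le_trans (FC y yx) _; apply: ler_pM => //.
- by rewrite invr_ge0 exprn_ge0// enorm_ge0.
- by rewrite lerDl.
by rewrite -exprVn -exprM mulnC exprM lerXn2r// nnegrE ?invr_ge0 ?enorm_ge0// exprn_ge0.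
Qed.

End decay.

(** * Harmonic polynomials and the fundamental solution *)

Section derivatives.
Variables (R : realType) (n : nat).
Implicit Types x y z : 'rV[R]_n.

(** Moves a directional derivative to the real line, where the rules for sums, powers, [ln] and
    [Num.sqrt] can be composed. *)
Lemma is_derive_line (f : 'rV[R]_n -> R) x v (d : R) :
  is_derive (0 : R) 1 (fun h : R => f (h *: v + x)) d -> is_derive x v f d.
Proof.
move=> [df <-]; have e : (fun h : R => h^-1 *: (f (h *: v + x) - f x)) =
  (fun h : R => h^-1 *: (f ((h *: 1 + 0) *: v + x) - f (0 *: v + x))).
  by apply/funext => h; rewrite addr0 scale0r add0r [_%:A]mulr1.
by split; [rewrite /derivable e|rewrite /derive e].
Qed.

Lemma is_derive_coord x (i j : 'I_n) :
  is_derive x (delta_mx 0 i) (fun z => z 0 j : R) ((i == j)%:R).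
Proof.
apply: is_derive_line.
rewrite (_ : (fun h => _) = (fun h : R => (i == j)%:R * h + x 0 j)); last first.
  by apply/funext => h; rewrite !mxE eqxx eq_sym mulrC.
by apply: is_derive_eq; rewrite addr0 [_%:A]mulr1.
Qed.

(** Formal and analytic derivatives agree on constants and variables, and the agreement is stable
    under sums and products. *)
Lemma is_derive_meval (p : mpoly n R) x (i : 'I_n) :
  is_derive x (delta_mx 0 i) (fun z => meval (fun j => z 0 j) p)
    (meval (fun j => x 0 j) (mderiv i p)).
Proof.
pose P p := is_derive x (delta_mx 0 i) (fun z => meval (fun j => z 0 j) p)
    (meval (fun j => x 0 j) (mderiv i p)).
have PC c : P (mpolyC n c).
  rewrite /P mderivC meval0.
  under eq_fun do rewrite mevalC.
  exact: is_derive_cst.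
have PM p1 p2 : P p1 -> P p2 -> P (p1 * p2).
  move=> h1 h2; rewrite /P mderivM mevalD !mevalM.
  under eq_fun do rewrite mevalM.
  have h3 := is_deriveM h1 h2; apply: is_derive_eq.
  by rewrite addrC; congr (_ + _); rewrite [RHS]mulrC.
have PD p1 p2 : P p1 -> P p2 -> P (p1 + p2).
  move=> h1 h2; rewrite /P mderivD mevalD.
  under eq_fun do rewrite mevalD.
  exact: is_deriveD h1 h2.
have PX j : P (mpolyX R (mnm1 j)).
  rewrite /P mderivX mevalZ mevalX.
  under eq_fun do rewrite mevalXU.
  have h := is_derive_coord x i j; apply: is_derive_eq.
  rewrite mnm1E eq_sym; have [->|_] := eqVneq j i; last by rewrite mul0r.
  rewrite mul1r big1// => k _.
  by rewrite mnmBE subnn expr0.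
have PXm m : P (mpolyX R m).
  rewrite mpolyXE_id; apply: (big_ind P); first exact: (PC 1).
    exact: PM.
  move=> j _; elim: (m j) => [|k IHk]; first exact: (PC 1).
  by rewrite exprS; apply: PM.
rewrite -/(P p); elim/mpolyind: p => [|c m p _ _ Pp].
  by rewrite -mpolyC0; exact: PC.
by apply: PD => //; rewrite -mul_mpolyC; exact: PM.
Qed.

Lemma measurable_meval (p : mpoly n R) :
  measurable_fun [set: 'rV[R]_n] (fun z => meval (fun j => z 0 j) p).
Proof.
under eq_fun do rewrite mevalE.
apply: measurable_sum => m; apply: measurable_funM => //.
apply: measurable_prod => i _; apply: measurable_funX; exact: measurable_coord.
Qed.

Lemma mderiv_ishomog (p : mpoly n R) l i : p \is ishomog1 l mdeg ->
  mderiv i p \is ishomog1 l.-1 mdeg.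
Proof.
move=> /dhomogP pl; apply/dhomogP => m; rewrite mcoeff_msupp mcoeff_mderiv => pm.
have /pl /= <- : mnm_add m (mnm1 i) \in msupp p.
  by rewrite mcoeff_msupp; apply: contraNneq pm => ->; rewrite mul0rn.
by rewrite mdegD mdeg1 addn1.
Qed.

Lemma meval_homog_bound (p : mpoly n R) l : p \is ishomog1 l mdeg ->
  exists2 C, 0 <= C & forall x, `|meval (fun j => x 0 j) p| <= C * weight x ^+ l.
Proof.
move=> /dhomogP pl; exists (\sum_(m <- msupp p) `|mcoeff m p|).
  by apply: sumr_ge0.
move=> x; rewrite mevalE (le_trans (ler_norm_sum _ _ _))// mulr_suml.
rewrite !big_seq; apply: ler_sum => m /pl /= <-.
rewrite normrM ler_wpM2l// normr_prod mdegE -prodrXr.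
apply: ler_prod => i _; rewrite normr_ge0/= normrX lerXn2r ?nnegrE//.
  exact: ltW (weight_gt0 x).
exact: le_trans (coord_le_enorm _ _) (enorm_le_weight _).
Qed.

(** For $n \geqslant 2$ this is $-1/\sigma_n$ (with $\sigma_2=2\pi$), written as each case of
    [fundsol] produces it: the gradient in $y$ of $e(x-y)$ is this constant times
    $(x-y)/|x-y|^n$. *)
Definition fundsol_const : R :=
  if n == 2%N then - (2 * pi)^-1 else (n - 2)%:R / (sphere_area R n * (2 - n%:R)).

Lemma is_derive_enorm_sub x y i : y != x ->
  is_derive (0 : R) 1 (fun h : R => enorm (x - (h *: delta_mx 0 i + y)))
    (- (x - y) 0 i / enorm (x - y)).
Proof.
move=> yx; rewrite /enorm.
have e0 : 0 < \sum_j (x - (0 *: delta_mx 0 i + y)) 0 j ^+ 2.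
  by rewrite -sqrtr_gt0 -/(enorm _) enorm_gt0 scale0r add0r subr_eq0 eq_sym.
have hd : is_derive (0 : R) 1
    (fun h : R => \sum_j (x - (h *: delta_mx 0 i + y)) 0 j ^+ 2)
    (- (x - y) 0 i *+ 2).
  pose g j (h : R) : R := (x - (h *: delta_mx 0 i + y)) 0 j ^+ 2.
  have hg j : is_derive (0 : R) 1 (g j) (- (x - y) 0 j *+ 2 * (j == i)%:R).
    rewrite /g (_ : (fun h => _) =
      (fun h : R => x 0 j - ((j == i)%:R * h + y 0 j)) ^+ 2); last first.
      by apply/funext => h; rewrite !mxE eqxx mulrC.
    apply: is_derive_eq.
    by rewrite !mxE [_%:A]mulr1 addr0 mulr0 add0r /= expr1 /GRing.scale/=; ring.
  have := is_derive_sum hg.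
  have -> : \sum_j - (x - y) 0 j *+ 2 * (j == i)%:R = - (x - y) 0 i *+ 2.
    rewrite (bigD1 i)//= eqxx mulr1 big1 ?addr0// => j /negbTE ->.
    by rewrite mulr0.
  by rewrite fct_sumE.
have hs := is_derive1_sqrt e0.
have hc := @is_derive1_comp _ _ _ _ _ _ hs hd.
apply: (@is_derive_eq _ _ _ _ _ _ _ _ hc).
have -> : x - (0 *: delta_mx 0 i + y) = x - y by rewrite scale0r add0r.
by rewrite -mulr_natr mulrC invfM; field; rewrite gt_eqF// -/(enorm _) enorm_gt0 subr_eq0 eq_sym.
Qed.

Lemma pderiv_fundsol_sub x y i (c : R) : (2 <= n)%N -> y != x ->
  pderiv i (fun z => fundsol (x - z) * c) y =
    c * (fundsol_const * (x - y) 0 i / enorm (x - y) ^+ n).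
Proof.
move=> n2 yx; have h := is_derive_enorm_sub i yx.
have S0 : 0 < enorm (x - y) by rewrite enorm_gt0 subr_eq0 eq_sym.
have xy0 : x - (0 *: delta_mx 0 i + y) = x - y by rewrite scale0r add0r.
have S0' : 0 < enorm (x - (0 *: delta_mx 0 i + y)) by rewrite xy0.
pose g (h : R) := enorm (x - (h *: delta_mx 0 i + y)).
apply: (@derive_val _ _ _ _ _ (fun z => fundsol (x - z) * c)).
apply: is_derive_line; rewrite /fundsol /fundsol_const.
have [n2E|n2E] := eqVneq n 2%N.
  have hl := is_derive1_ln S0'.
  have hc := @is_derive1_comp _ (@ln R) g _ _ _ hl h.
  rewrite (_ : (fun _ => _) = (c / (2 * pi)) \*: (@ln R \o
g)); last first.
    by apply/funext => t /=; rewrite /GRing.scale/=; ring.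
  apply: is_derive_eq.
  have -> : enorm (x - y) ^+ n = enorm (x - y) ^+ 2 by congr (_ ^+ _).
  rewrite xy0 /GRing.scale/=; have := pi_gt0 R; move: (pi : R) => p p0; field.
  by rewrite (gt_eqF S0) (gt_eqF p0).
have g0 : (g ^+ (n - 2)) 0 != 0.
  by rewrite fctE expf_neq0// gt_eqF.
have hX := @is_deriveX _ _ g (n - 2) _ _ _ h.
have hV := is_deriveV g0 hX.
have -> : (fun h0 : R => enorm (x - (h0 *: delta_mx 0 i + y)) ^- (n - 2) /
    (sphere_area R n * (2 - n%:R)) * c) = ((sphere_area R n * (2 - n%:R))^-1 * c) \*:
  (fun t => ((g ^+ (n - 2)) t)^-1).
  by apply/funext => t /=; rewrite /GRing.scale/= fctE -mulrA mulrC.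
apply: is_derive_eq.
rewrite fctE /g xy0 /GRing.scale/=.
move: (enorm (x - y)) S0 ((x - y) 0 i) (_^-1) => E E0 X k.
(* In this branch $n \geqslant 3$; the substitution makes the truncated subtractions in the
   exponents compute. *)
have [m ->] : exists m, n = m.+3.
  by exists (n - 3)%N; rewrite -addn3 subnK// ltn_neqAle eq_sym n2E.
rewrite !subSS subn0 /= !exprS.
have Em : E ^+ m != 0 by rewrite expf_neq0// gt_eqF.
by move: Em; move: (E ^+ m) => Em Em0; field; rewrite Em0 gt_eqF.
Qed.

End derivatives.

(** * Derivation under the integral sign on [[0, T]] *)

Section parameter_integral.
Variables (d : measure_display) (X : measurableType d) (R : realType).
Variable mu : {measure set X -> \bar R}.

Lemma cvg_Rintegral_within (D : set R) (p : R) (phi : R -> X -> R)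
    (phi0 G : X -> R) :
  (forall e, D e -> e != p -> measurable_fun [set: X] (phi e)) ->
  measurable_fun [set: X] phi0 ->
  mu.-integrable [set: X] (EFin \o G) ->
  (forall e y, D e -> e != p -> `|phi e y| <= G y) ->
  (forall y, `|phi0 y| <= G y) ->
  (forall y, phi e y @[e --> within D p^'] --> phi0 y) ->
  (\int[mu]_y phi e y) @[e --> within D p^'] --> \int[mu]_y phi0 y.
Proof.
move=> mphi mphi0 iG phiG phi0G cphi.
(* Outside [D] the integrand is replaced by its limit [phi0]. Domination and convergence then hold
   along the full punctured neighbourhood, and the limit can be tested on sequences by dominated
   convergence. *)
pose E e := `[< D e /\ e != p >].
pose psi e y := if E e then phi e y else phi0 y.
have mpsi e : measurable_fun [set: X] (psi e).
  by rewrite /psi /E; case: asboolP => // -[De ep]; exact: mphi.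
have psiG e y : `|psi e y| <= G y.
  by rewrite /psi /E; case: asboolP => // -[De ep]; exact: phiG.
have ipsi e : mu.-integrable [set: X] (EFin \o psi e).
  apply: le_integrable iG => //; first exact/measurable_EFinP.
  move=> y _ /=; rewrite lee_fin; exact: le_trans (psiG e y) (ler_norm _).
have iphi0 : mu.-integrable [set: X] (EFin \o phi0).
  apply: le_integrable iG => //; first exact/measurable_EFinP.
  move=> y _ /=; rewrite lee_fin; exact: le_trans (phi0G y) (ler_norm _).
have cpsi y : psi e y @[e --> p^'] --> phi0 y.
  apply/cvgrPdist_lt => eps eps0.
  have h : \forall e \near p^', D e -> `|phi0 y - phi e y| < eps.
    by have /cvgrPdist_lt/(_ _ eps0) := cphi y.
  apply: filterS h => e he.
  rewrite /psi /E; case: asboolP => [[De ep]|_]; last by rewrite subrr normr0.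
  exact: he.
suff : (\int[mu]_y psi e y) @[e --> p^'] --> \int[mu]_y phi0 y.
  move=> /cvgrPdist_lt h; apply/cvgrPdist_lt => eps eps0.
  suff : \forall e \near p^', D e ->
    `|\int[mu]_y phi0 y - \int[mu]_y phi e y| < eps by [].
  have {}h := h _ eps0; near=> e => De.
  have ep : e != p by near: e; exact: nbhs_dnbhs_neq.
  rewrite (_ : phi e = psi e); first by near: e.
  by apply/funext => y; rewrite /psi /E asboolT.
apply/cvgr_dnbhsP => u [up cu].
have := @dominated_convergence _ _ _ mu [set: X] measurableT
  (fun k y => (psi (u k) y)%:E) (EFin \o phi0) (EFin \o G) _ _ _ iG _.
case.
- by move=> k; exact/measurable_EFinP.
- exact/measurable_EFinP.
- apply: aeW => y _ /=; apply: cvg_EFin; first exact: nearW.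
  have /cvgr_dnbhsP := cpsi y; exact.
- by apply: aeW => y k _ /=; rewrite lee_fin.
move=> _ _ h; rewrite /Rintegral; apply: fine_cvg.
rewrite fineK//; exact: integrable_fin_num.
Unshelve. all: by end_near. Qed.

End parameter_integral.

(** * Derivatives on a closed interval *)

Section one_sided_derivatives.
Variables (R : realType) (T : R).
Hypothesis T0 : 0 < T.
Implicit Types g : R -> R.

(** Properness makes the limit defining [tderiv] unique. There is room to the right of [t] if $t<T$,
    and to the left if $t=T$, since $T>0$. *)
Lemma within_itv_dnbhs_proper t : 0 <= t <= T ->
  ProperFilter (within (fun e => 0 <= t + e <= T) (0 : R)^').
Proof.
move=> /andP[t0 tT]; apply: Build_ProperFilter => -[r /= r0 Pr].
have [tT'|Tt] := ltP t T.
  pose e := Num.min (r / 2) (T - t).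
  have e0 : 0 < e by rewrite lt_min divr_gt0//= subr_gt0.
  apply: (Pr e).
  - rewrite /ball/= sub0r normrN gtr0_norm// gt_min ltr_pdivrMr//.
    by rewrite mulr_natr mulr2n ltrDr r0.
  - by rewrite gt_eqF.
  - by rewrite addr_ge0 ?(ltW e0)//= -lerBrDl ge_min lexx orbT.
pose e := Num.min (r / 2) T.
have e0 : 0 < e by rewrite lt_min divr_gt0.
apply: (Pr (- e)).
- rewrite /ball/= sub0r opprK gtr0_norm// gt_min ltr_pdivrMr//.
  by rewrite mulr_natr mulr2n ltrDr r0.
- by rewrite oppr_eq0 gt_eqF.
- have eT : e <= T by rewrite ge_min lexx orbT.
  by lra.
Qed.

(** Identities between functions of $t$ are available only on $[0,T]$; the restricted filter sees no
    other values, so such identities can be differentiated. *)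
Lemma eq_quot_at g1 g2 t : 0 <= t <= T ->
  (forall r, 0 <= r <= T -> g1 r = g2 r) -> quot_at T g1 t = quot_at T g2 t.
Proof.
move=> tT.
suff sub g g' : (forall r, 0 <= r <= T -> g r = g' r) ->
    quot_at T g t `<=` quot_at T g' t.
  by move=> g12; apply/seteqP; split; apply: sub => // r rT; rewrite g12.
move=> gg' P h.
suff : \forall e \near (0 : R)^', 0 <= t + e <= T ->
  P (e^-1 * (g' (t + e) - g' t)) by [].
have {}h : \forall e \near (0 : R)^', 0 <= t + e <= T ->
  P (e^-1 * (g (t + e) - g t)) by [].
by apply: filterS h => e h eT; rewrite -!gg'//; exact: h.
Qed.

Lemma eq_tderivs g1 g2 j t : 0 <= t <= T ->
  (forall r, 0 <= r <= T -> g1 r = g2 r) -> tderivs T j g1 t = tderivs T j g2 t.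
Proof.
move=> + g12; elim: j t => [|j IHj] t tT; first exact: g12.
by rewrite /tderivs !iterS /tderiv (eq_quot_at tT IHj).
Qed.

Lemma tderiv_val g t l : 0 <= t <= T -> quot_at T g t --> l -> tderiv T g t = l.
Proof.
move=> tT h; have F := within_itv_dnbhs_proper tT.
exact: (cvg_lim (@Rhausdorff R) h).
Qed.

Lemma tderiv_is_derive g t : 0 < t < T -> tderivable T g t ->
  is_derive t 1 g (tderiv T g t).
Proof.
move=> /andP[t0 tT] gt.
have {}gt : quot_at T g t --> tderiv T g t by [].
have h : (fun h => h^-1 *: (g (h *: (1 : R) + t) - g t)) @ (0 : R)^' --> tderiv T g t.
  apply/cvgrPdist_lt => eps eps0.
  have h : \forall e \near (0 : R)^', 0 <= t + e <= T ->
      `|tderiv T g t - e^-1 * (g (t + e) - g t)| < eps.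
    by have /cvgrPdist_lt/(_ _ eps0) := gt.
  near=> e.
  rewrite [_%:A]mulr1 [e + t]addrC.
  suff : 0 <= t + e <= T by near: e; exact: h.
  have : `|e| < Num.min t (T - t).
    by near: e; apply: dnbhs0_lt; rewrite lt_min t0 subr_gt0.
  by rewrite lt_min ltr_norml => /andP[/andP[e1 e2]]; rewrite ltr_norml => /andP[e3 e4]; lra.
by apply: DeriveDef; [exact: cvgP h|exact: (cvg_lim (@Rhausdorff R) h)].
Unshelve. all: by end_near. Qed.

(** The mean value theorem asks for two-sided derivatives only in the open interval, where [tderiv]
    provides them. The bound serves to dominate difference quotients uniformly in the step. *)
Lemma tderiv_lipschitz g (M a b : R) :
  {within `[0, T], continuous g} ->
  (forall t, 0 <= t <= T -> tderivable T g t) ->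
  (forall t, 0 <= t <= T -> `|tderiv T g t| <= M) ->
  0 <= a <= T -> 0 <= b <= T -> `|g b - g a| <= M * `|b - a|.
Proof.
move=> cg dg gM; wlog ab : a b / a < b.
  move=> hw aT bT; have [ab|ba|->] := ltgtP a b; first exact: hw.
    by rewrite distrC (distrC b); exact: hw.
  by rewrite !subrr normr0 mulr0.
move=> /andP[a0 aT] /andP[b0 bT].
have [c|//|c cab ->] := @MVT R g (tderiv T g) a b ab.
- rewrite in_itv/= => /andP[ac cb]; apply: tderiv_is_derive.
    by rewrite (le_lt_trans a0 ac) (lt_le_trans cb bT).
  by apply: dg; rewrite (ltW (le_lt_trans a0 ac)) (ltW (lt_le_trans cb bT)).
- apply: continuous_subspaceW cg => x /=; rewrite !in_itv/= => /andP[ax xb].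
  by rewrite (le_trans a0 ax) (le_trans xb bT).
- move: cab; rewrite in_itv/= normrM => /andP[ac cb]; apply: ler_wpM2r => //.
  by apply: gM; rewrite (ltW (le_lt_trans a0 ac)) (ltW (lt_le_trans cb bT)).
Qed.

End one_sided_derivatives.

Section derivation_under_integral.
Variables (d : measure_display) (X : measurableType d) (R : realType).
Variable mu : {measure set X -> \bar R}.
Variables (T : R) (T0 : 0 < T).

Lemma Cn_on_Rintegral (s : nat) (u : X -> R -> R) (G : X -> R) :
  mu.-integrable [set: X] (EFin \o G) ->
  (forall y, Cn_on T s (u y)) ->
  (forall j t, (j <= s)%N -> 0 <= t <= T ->
     measurable_fun [set: X] (fun y => tderivs T j (u y) t)) ->
  (forall j t y, (j <= s)%N -> 0 <= t <= T -> `|tderivs T j (u y) t| <= G y) ->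
  Cn_on T s (fun t => \int[mu]_y u y t).
Proof.
move=> iG Cu mu' uG.
(* Candidate for the $j$-th derivative of the integral: [dv] computes the derivative of [v j], then
   [vE] identifies the candidate by induction on [j]. *)
pose v j t := \int[mu]_y tderivs T j (u y) t.
have dv j t : (j < s)%N -> 0 <= t <= T -> quot_at T (v j) t --> v j.+1 t.
  move=> js tT; have jls := ltnW js.
  have integ k r : (k <= s)%N -> 0 <= r <= T ->
      mu.-integrable [set: X] (EFin \o (fun y => tderivs T k (u y) r)).
    move=> ks rT; apply: le_integrable iG => //.
      by apply/measurable_EFinP; exact: mu'.
    move=> y _ /=; rewrite lee_fin.
    by apply: le_trans (ler_norm _); exact: uG.
  have h : (\int[mu]_y (e^-1 * (tderivs T j (u y) (t + e) - tderivs T j (u y) t)))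
      @[e --> within (fun e => 0 <= t + e <= T) (0 : R)^'] --> v j.+1 t.
    apply: (cvg_Rintegral_within _ _ iG) => //.
    - move=> e eT e0; apply: measurable_funM => //.
      by apply: measurable_funB; exact: mu'.
    - exact: mu'.
    (* The quotient is dominated by [G y], because the derivative of order [j.+1] is at most [G y]
       on the whole interval. *)
    - move=> e y eT e0; rewrite normrM normfV ler_pdivrMl ?normr_gt0// mulrC.
      have -> : `|e| = `|t + e - t| by rewrite addrAC subrr add0r.
      apply: (@tderiv_lipschitz R T) => //.
      + by have [+ _] := Cu y; exact.
      + by move=> r rT; have [_ +] := Cu y; exact.
      + by move=> r rT; exact: (uG j.+1).
    - by move=> y; exact: uG.
    - by move=> y; have [_ /(_ j t js tT)] := Cu y.
  apply: cvg_trans h; apply: near_eq_cvg.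
  suff : \forall e \near (0 : R)^', 0 <= t + e <= T ->
    \int[mu]_y (e^-1 * (tderivs T j (u y) (t + e) - tderivs T j (u y) t)) =
    e^-1 * (v j (t + e) - v j t) by [].
  near=> e => eT.
  rewrite RintegralZl//; last first.
    have := integrableB measurableT (integ j _ jls eT) (integ j _ jls tT).
    by apply: eq_integrable.
  by rewrite RintegralB//; exact: integ.
have vE j t : (j <= s)%N -> 0 <= t <= T ->
    tderivs T j (fun t => \int[mu]_y u y t) t = v j t.
  elim: j t => [//|j IHj] t js tT.
  rewrite /tderivs iterS -/(tderivs _ _ _) /tderiv (@eq_quot_at _ _ _ (v j))//.
    by apply: tderiv_val => //; exact: dv.
  by move=> r rT; apply: IHj => //; exact: ltnW.
split => [j js|j t js tT]; last first.
  rewrite /tderivable (@eq_quot_at _ _ _ (v j))//; last first.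
    by move=> r rT; apply: vE => //; exact: ltnW.
  apply: cvgP; exact: dv.
apply/subspace_continuousP => t /=; rewrite in_itv/= => tT.
have h : v j e @[e --> within (fun e => 0 <= e <= T) t^'] --> v j t.
  apply: (cvg_Rintegral_within _ _ iG) => //.
  - by move=> e eT _; exact: mu'.
  - exact: mu'.
  - by move=> e y eT _; exact: uG.
  - by move=> y; exact: uG.
  move=> y; have [/(_ j js) /subspace_continuousP/(_ t) + _] := Cu y.
  rewrite /= in_itv/= => /(_ tT) h.
  apply/cvgrPdist_lt => eps eps0.
  have {}h : \forall e \near t, 0 <= e <= T ->
      `|tderivs T j (u y) t - tderivs T j (u y) e| < eps.
    have {}h : \forall e \near t, `[0, T]%classic e ->
        `|tderivs T j (u y) t - tderivs T j (u y) e| < eps.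
      by have /cvgrPdist_lt/(_ _ eps0) := h.
    by apply: filterS h => e he eT; apply: he; rewrite /= in_itv.
  suff : \forall e \near t^', 0 <= e <= T ->
    `|tderivs T j (u y) t - tderivs T j (u y) e| < eps by [].
  exact: nbhs_dnbhs h.
(* The convergence just obtained is along a punctured neighbourhood, whereas continuity also
   involves the point [t] itself, where the difference is zero. *)
apply/cvgrPdist_lt => eps eps0.
have {}h : \forall e \near t^', 0 <= e <= T -> `|v j t - v j e| < eps.
  by have /cvgrPdist_lt/(_ _ eps0) := h.
have : \forall e \near t, e != t -> 0 <= e <= T -> `|v j t - v j e| < eps by [].
move=> {}h; suff : \forall e \near t, `[0, T]%classic e ->
  `|tderivs T j (fun r => \int[mu]_y u y r) t -
    tderivs T j (fun r => \int[mu]_y u y r) e| < eps by [].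
apply: filterS h => e he; rewrite /= in_itv /= => eT.
rewrite !vE//; have [->|et] := eqVneq e t; first by rewrite subrr normr0.
exact: he.
Unshelve. all: by end_near. Qed.

End derivation_under_integral.

(** * Weighted spaces *)

Section weighted_bounds.
Variables (R : realType) (n : nat) (lam T : R) (U : set 'rV[R]_n).
Hypotheses (n0 : (0 < n)%N) (T0 : 0 <= T) (bU : bounded_set U).
Implicit Types (x y : 'rV[R]_n) (v : 'rV[R]_n -> R) (u : 'rV[R]_n -> R -> R).

(* Without a Hoelder pair the Hoelder seminorm would be the supremum of the empty
   set, i.e. -oo, and the finiteness of norm0 would give no bound. *)
Lemma hoelder_pair_nonempty : exists p, hoelder_pair U p.
Proof.
have [M0 [_ HM]] := bU.
pose M := Num.max (M0 + 1) 0; have M_ge0 : 0 <= M by rewrite le_max lexx orbT.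
have UM x : U x -> `|x| <= M.
  by apply: HM; rewrite lt_max ltrDl ltr01.
pose i := Ordinal n0.
have coord x : `|x 0 i| <= `|x|.
  by rewrite [leRHS]mx_normrE (le_bigmax _ (fun j => `|x j.1 j.2|) (0, i)).
have enormd c : enorm (c *: delta_mx 0 i : 'rV[R]_n) = `|c|.
  rewrite /enorm (bigD1 i)//= big1 ?addr0; last first.
    by move=> j /negbTE ji; rewrite !mxE ji andbF mulr0 expr0n.
  by rewrite !mxE !eqxx mulr1 sqrtr_sqr.
have notU c : M < c -> ~ U (c *: delta_mx 0 i).
  move=> Mc /UM; apply/negP; rewrite -ltNge; apply: lt_le_trans (coord _).
  by rewrite !mxE !eqxx mulr1 (lt_le_trans Mc)// ler_norm.
exists ((M + 2) *: delta_mx 0 i, (M + 3) *: delta_mx 0 i); split => /=.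
- by apply: notU; rewrite ltrDl.
- by apply: notU; rewrite ltrDl.
- apply/eqP => /rowP/(_ i); rewrite !mxE !eqxx !mulr1 => h; lra.
rewrite -scalerBl !enormd.
have -> : M + 2 - (M + 3) = - 1 by ring.
rewrite normrN normr1 ger0_norm; lra.
Qed.

Lemma norm00_ge0 delta v : (0 <= norm00 delta v)%E.
Proof.
apply: (@le_trans _ _ (weight 0 `^ delta * `|v 0|)%:E).
  by rewrite lee_fin mulr_ge0// powR_ge0.
by apply: ereal_sup_ubound; exists 0.
Qed.

Lemma hoelder00_ge0 delta v : (0 <= hoelder00 lam U delta v)%E.
Proof.
have [p Up] := hoelder_pair_nonempty.
apply: (@le_trans _ _ (weight2 p.1 p.2 `^ (delta + lam) * `|v p.1 - v p.2|
                  / enorm (p.1 - p.2) `^ lam)%:E).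
  by rewrite lee_fin !mulr_ge0 ?invr_ge0 ?powR_ge0.
by apply: ereal_sup_ubound; exists p.
Qed.

Lemma sup_norm00_ge0 delta u :
  (0 <= ereal_sup [set norm00 delta (u ^~ t) | t in `[0%R, T]])%E.
Proof.
apply: le_trans (norm00_ge0 delta (u ^~ 0)) _.
by apply: ereal_sup_ubound; exists 0 => //=; rewrite in_itv/= lexx.
Qed.

Lemma sup_hoelder00_ge0 delta u :
  (0 <= ereal_sup [set hoelder00 lam U delta (u ^~ t) | t in `[0%R, T]])%E.
Proof.
apply: le_trans (hoelder00_ge0 delta (u ^~ 0)) _.
by apply: ereal_sup_ubound; exists 0 => //=; rewrite in_itv/= lexx.
Qed.

Lemma norm0_ge0 delta u : (0 <= norm0 lam T U delta u)%E.
Proof. by rewrite adde_ge0// ?sup_norm00_ge0 ?sup_hoelder00_ge0. Qed.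

(** The Hölder part being non-negative, finiteness of the sum bounds the sup part, which alone gives
    the decay. *)
Lemma norm0_bound delta u : (norm0 lam T U delta u < +oo)%E ->
  exists2 C, 0 <= C &
    forall x t, 0 <= t <= T -> `|u x t| <= C * weight x `^ (- delta).
Proof.
rewrite /norm0; set A := ereal_sup _; set B := ereal_sup _ => AB.
have A0 : (0 <= A)%E := sup_norm00_ge0 delta u.
have B0 : (0 <= B)%E := sup_hoelder00_ge0 delta u.
have Afin : A \is a fin_num.
  by rewrite ge0_fin_numE//; apply: le_lt_trans AB; rewrite leeDl.
exists (fine A) => [|x t tT]; first exact: fine_ge0.
rewrite powRN ler_pdivlMr ?powR_gt0 ?weight_gt0// mulrC -lee_fin fineK//.
apply: (@le_trans _ _ (norm00 delta (u ^~ t))).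
  by apply: ereal_sup_ubound; exists x.
by apply: ereal_sup_ubound; exists t.
Qed.

Lemma norm2s_ge0 s delta u : (0 <= norm2s lam T U s delta u)%E.
Proof. by apply: sume_ge0 => j _; apply: sume_ge0 => al _; exact: norm0_ge0. Qed.

Lemma multi_seq0 k : multi_seq [ffun=> ord0 : 'I_k.+1] = [::] :> seq 'I_n.
Proof.
rewrite /multi_seq; elim: (enum _) => //= i r ->.
by rewrite ffunE.
Qed.

Lemma mdeg_ffun0 k : mdeg_ffun ([ffun=> ord0] : {ffun 'I_n -> 'I_k.+1}) = 0%N.
Proof. by apply: big1 => i _; rewrite ffunE. Qed.

(** All terms of the norm are non-negative, so the single term with both multi-indices zero and time
    order [j] is finite. No space derivative is taken in it, so its weight is exactly [delta]. *)
Lemma space2sk_bound s k delta u j : space2sk lam T U s k delta u ->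
  (j <= s)%N -> exists2 C, 0 <= C &
    forall x t, 0 <= t <= T -> `|tderivs T j (u x) t| <= C * weight x `^ (- delta).
Proof.
move=> [_ un] js; apply: norm0_bound; apply: le_lt_trans un.
have js' : (j < s.+1)%N by [].
pose be : {ffun 'I_n -> 'I_k.+1} := [ffun=> ord0].
pose al : {ffun 'I_n -> 'I_(2 * s).+1} := [ffun=> ord0].
rewrite /norm2sk (bigD1 be)/=; last by rewrite mdeg_ffun0.
apply: le_trans (leeDl _ _); last by apply: sume_ge0 => *; exact: norm2s_ge0.
rewrite /norm2s (bigD1 (Ordinal js'))//=.
apply: le_trans (leeDl _ _); last first.
  by apply: sume_ge0 => *; apply: sume_ge0 => *; exact: norm0_ge0.
rewrite (bigD1 al)/=; last by rewrite mdeg_ffun0 add0n leq_mul2l js.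
apply: le_trans (leeDl _ _); last by apply: sume_ge0 => *; exact: norm0_ge0.
by rewrite !mdeg_ffun0 !multi_seq0 !addr0.
Qed.

(** Joint continuity is restricted to the slice $\{x\}\times[0,T]$, with the empty list of space
    derivatives. *)
Lemma space2sk_Cn_on s k delta u x : space2sk lam T U s k delta u ->
  Cn_on T s (u x).
Proof.
move=> [[_ /(_ [::] (leq0n k)) [_ ud uc]] _]; split => [j js|j t js tT].
  have h : continuous_cyl T (dt T j u).
    by have := uc [::] j; apply; rewrite add0n leq_mul2l js.
  apply/subspace_continuousP => t tT.
  have /subspace_continuousP/(_ (x, t)) := h.
  move=> /(_ (conj I tT)) {}h.
  apply/cvgrPdist_lt => eps eps0.
  have {}h : \forall p \near (x, t), ([set: 'rV[R]_n] `*` `[0, T]) p ->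
      `|dt T j u x t - dt T j u p.1 p.2| < eps.
    by have /cvgrPdist_lt/(_ _ eps0) := h.
  have xt : (x, r) @[r --> t] --> (x, t).
    exact: (cvg_pair (f := fun=> x) (g := id) (cvg_cst x) cvg_id).
  suff : \forall r \near t, `[0, T]%classic r ->
    `|tderivs T j (u x) t - tderivs T j (u x) r| < eps by [].
  have {}h : \forall r \near t, ([set: 'rV[R]_n] `*` `[0, T]) (x, r) ->
      `|dt T j u x t - dt T j u x r| < eps by exact: (xt _ h).
  by apply: filterS h => r hr rT; exact: hr.
by have := ud [::] j x t; apply => //; rewrite add0n leq_mul2l.
Qed.

Lemma space2sk_measurable s k delta u j t : space2sk lam T U s k delta u ->
  (j <= s)%N -> 0 <= t <= T ->
  measurable_fun [set: 'rV[R]_n] (fun x => tderivs T j (u x) t).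
Proof.
move=> [[_ /(_ [::] (leq0n k)) [_ ud uc]] _] js tT.
apply: continuous_measurable_rV => x.
have h : continuous_cyl T (dt T j u) by have := uc [::] j; apply; rewrite add0n leq_mul2l js.
have tT' : `[0, T]%classic t by rewrite /= in_itv.
have /subspace_continuousP/(_ (x, t)) := h.
move=> /(_ (conj I tT')) {}h.
suff : tderivs T j (u z) t @[z --> nbhs x] --> tderivs T j (u x) t by [].
apply/cvgrPdist_lt => eps eps0.
have {}h : \forall p \near (x, t), ([set: 'rV[R]_n] `*` `[0, T]) p ->
    `|dt T j u x t - dt T j u p.1 p.2| < eps.
  by have /cvgrPdist_lt/(_ _ eps0) := h.
have [[A B] [/= xA tB] AB] := h.
apply: (filterS _ xA) => r Ar.
exact: (AB (r, t) (conj Ar (nbhs_singleton tB)) (conj I tT')).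
Qed.

End weighted_bounds.

(** * Integrability against the gradient of the fundamental solution *)

Section newton_kernel.
Variables (R : realType) (n : nat).
Hypothesis n2 : (2 <= n)%N.
Implicit Types x y z : 'rV[R]_n.

Lemma measurable_enorm_sub z :
  measurable_fun [set: 'rV[R]_n] (fun y => enorm (z - y) : measurableTypeR R).
Proof.
apply: (@measurableT_comp _ _ _ _ _ _ (@enorm R n)); first exact: measurable_enorm.
apply: measurable_rowP => i; under eq_fun do rewrite !mxE.
by apply: measurable_funB => //; exact: measurable_coord.
Qed.

(* At y = z the derivative is a junk value, whence the corrective term supported
   by {z}. *)
Lemma measurable_pderiv_fundsol z i c : measurable_fun [set: 'rV[R]_n]
  (fun y => pderiv i (fun x => fundsol (z - x) * c) y).
Proof.
pose P y := pderiv i (fun x => fundsol (z - x) * c) y.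
pose E y : R := c * (fundsol_const R n * (z - y) 0 i / enorm (z - y) ^+ n).
rewrite (_ : (fun _ => _) = fun y => E y + (P z - E z) * \1_[set z] y); last first.
  apply/funext => y; rewrite indicE; have [->|yz] := eqVneq y z.
    by rewrite mem_set// mulr1 addrC subrK.
  rewrite memNset; last by move=> /= yz'; rewrite yz' eqxx in yz.
  by rewrite mulr0 addr0 /E pderiv_fundsol_sub.
apply: measurable_funD; last first.
  apply: measurable_funM => //; apply: measurable_indic; exact: measurable_set1_rV.
rewrite /E; apply: measurable_funM => //; apply: measurable_funM.
  apply: measurable_funM => //; under eq_fun do rewrite !mxE.
  by apply: measurable_funB => //; exact: measurable_coord.
under eq_fun do rewrite -powR_invn ?enorm_ge0//.
apply: (@measurableT_comp _ _ _ _ _ _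
    (fun r => powR r (- n%:R) : measurableTypeR R)); first exact: measurable_powR.
exact: measurable_enorm_sub.
Qed.

Lemma pderiv_fundsol_bound z y i c : y != z ->
  `|pderiv i (fun x => fundsol (z - x) * c) y| <=
  `|c * fundsol_const R n| / enorm (z - y) ^+ n.-1.
Proof.
move=> yz; have S0 : 0 < enorm (z - y) by rewrite enorm_gt0 subr_eq0 eq_sym.
rewrite pderiv_fundsol_sub// mulrA mulrA normrM normrM -mulrA; apply: ler_wpM2l => //.
rewrite normfV (ger0_norm (exprn_ge0 _ (enorm_ge0 _))).
rewrite ler_pdivrMr ?exprn_gt0//.
have -> : enorm (z - y) ^+ n = enorm (z - y) * enorm (z - y) ^+ n.-1.
  by rewrite -exprS prednK// (ltn_trans _ n2).
rewrite mulrCA mulVf; first by rewrite mulr1 coord_le_enorm.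
by rewrite expf_neq0// gt_eqF.
Qed.

(** Within distance 1 of [z], [v] is bounded and the kernel has an integrable singularity; farther
    away the kernel is bounded and the decay of [v] suffices. *)
Lemma integrable_newton (v : 'rV[R]_n -> R) C a z i c :
  measurable_fun [set: 'rV[R]_n] v -> 0 <= C -> n%:R < a ->
  (forall y, `|v y| <= C * weight y `^ (- a)) ->
  (lebesgue_rV R n).-integrable [set: 'rV[R]_n]
    (EFin \o (fun y => v y * pderiv i (fun x => fundsol (z - x) * c) y)).
Proof.
move=> mv C0 na vC; set P := pderiv i _; set K := `|c * fundsol_const R n|.
have a0 : 0 <= a by apply: le_trans (ltW na); rewrite ler0n.
have K0 : 0 <= K by exact: normr_ge0.
have mP : measurable_fun [set: 'rV[R]_n] P by exact: measurable_pderiv_fundsol.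
pose B : set 'rV[R]_n := [set y | enorm (z - y) <= 1].
have mB : measurable B.
  rewrite (_ : B = (fun y => enorm (z - y) : measurableTypeR R) @^-1` `]-oo, 1]).
    by rewrite -[X in measurable X]setTI; apply: measurable_enorm_sub.
  by apply/seteqP; split => y /=; rewrite in_itv.
have i1 : (lebesgue_rV R n).-integrable [set: 'rV[R]_n]
    (EFin \o (fun y => v y * P y * \1_B y)).
  apply: (@integrable_singular _ _ _ z (C * K)) => //.
  - exact: ltn_trans n2.
  - apply: measurable_funM; last exact: measurable_indic.
    exact: measurable_funM.
  - exact: mulr_ge0.
  - move=> y yz; rewrite normrM -[leRHS]mulr1; apply: ler_pM => //; last first.
      by rewrite indicE; case: (_ \in _); rewrite ?normr0 ?normr1.
    rewrite normrM -mulrA; apply: ler_pM => //; last exact: pderiv_fundsol_bound.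
    apply: le_trans (vC y) _; rewrite -[leRHS]mulr1 ler_wpM2l//.
    have <- : 1 `^ (- a) = 1 :> R by rewrite powR1.
    by rewrite powRN_le// weight_ge1.
  - move=> y; rewrite indicE; case: (boolP (y \in B)) => [/set_mem//|_].
    by rewrite mulr0 eqxx.
have i2 : (lebesgue_rV R n).-integrable [set: 'rV[R]_n]
    (EFin \o (fun y => v y * P y * \1_(~` B) y)).
  apply: (@integrable_decay _ _ _ (C * K) a) => //.
  - apply: measurable_funM; last by apply: measurable_indic; exact: measurableC.
    exact: measurable_funM.
  - exact: mulr_ge0.
  - move=> y; rewrite indicE; case: (boolP (y \in ~` B)) => [/set_mem/negP yB|_].
      move: yB; rewrite -ltNge => yB.
      rewrite mulr1 normrM mulrAC; apply: ler_pM => //.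
      have yz : y != z.
        apply: contraTneq yB => ->; rewrite subrr -leNgt.
        by rewrite /enorm big1 ?sqrtr0// => j _; rewrite mxE expr0n.
      apply: le_trans (pderiv_fundsol_bound i c yz) _.
      rewrite ler_pdivrMr ?exprn_gt0 ?(lt_trans _ yB)//.
      by rewrite ler_peMr// exprn_ege1// ltW.
    by rewrite mulr0 normr0 !mulr_ge0// powR_ge0.
have := integrableD measurableT i1 i2; apply: eq_integrable => // y _ /=.
rewrite -EFinD -mulrDr; congr (_%:E).
rewrite !indicE in_setC; case: (_ \in _); rewrite /= ?addr0 ?add0r mulr1//.
Qed.

End newton_kernel.

(** * Linear combinations of functions of class $C^s$ on $[0,T]$ *)

Section Cn_on_linear.
Variables (R : realType) (T : R) (T0 : 0 < T).

Lemma tderivs_lin s c (g1 g2 : R -> R) j t : Cn_on T s g1 -> Cn_on T s g2 ->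
  (j <= s)%N -> 0 <= t <= T ->
  tderivs T j (fun t => c * g1 t + g2 t) t = c * tderivs T j g1 t + tderivs T j g2 t
  /\ ((j < s)%N -> tderivable T (tderivs T j (fun t => c * g1 t + g2 t)) t).
Proof.
move=> [_ d1] [_ d2] + tT.
have step i r : (i < s)%N -> 0 <= r <= T ->
    (forall r, 0 <= r <= T -> tderivs T i (fun t => c * g1 t + g2 t) r =
      c * tderivs T i g1 r + tderivs T i g2 r) ->
    quot_at T (tderivs T i (fun t => c * g1 t + g2 t)) r -->
      c * tderivs T i.+1 g1 r + tderivs T i.+1 g2 r.
  move=> js rT IHj; rewrite (eq_quot_at rT IHj).
  have h1 : quot_at T (tderivs T i g1) r --> tderivs T i.+1 g1 r by exact: d1.
  have h2 : quot_at T (tderivs T i g2) r --> tderivs T i.+1 g2 r by exact: d2.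
  have F := within_itv_dnbhs_proper T0 rT.
  rewrite /quot_at (_ : (fun e => _) = (fun e =>
      c * (e^-1 * (tderivs T i g1 (r + e) - tderivs T i g1 r)) +
      e^-1 * (tderivs T i g2 (r + e) - tderivs T i g2 r))); last first.
    by apply/funext => e; ring.
  by apply: cvgD => //; apply: cvgM => //; exact: cvg_cst.
have E i r : (i <= s)%N -> 0 <= r <= T ->
    tderivs T i (fun t => c * g1 t + g2 t) r =
      c * tderivs T i g1 r + tderivs T i g2 r.
  elim: i r => [//|i IHi] r js rT.
  rewrite [LHS]/tderivs iterS -/(tderivs _ _ _); apply: tderiv_val => //.
  by apply: step => // r' r'T; apply: IHi => //; exact: ltnW.
move=> js; split; first exact: E.
by move=> js'; apply: cvgP; apply: step => // r rT; exact: E.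
Qed.

Lemma Cn_on_lin s c (g1 g2 : R -> R) : Cn_on T s g1 -> Cn_on T s g2 ->
  Cn_on T s (fun t => c * g1 t + g2 t).
Proof.
move=> C1 C2; split=> [j js|j t js tT]; last first.
  by have [_] := tderivs_lin c C1 C2 (ltnW js) tT; apply.
have [[c1 _] [c2 _]] := (C1, C2).
have h : {within `[0, T], continuous (fun t => c * tderivs T j g1 t + tderivs T j g2 t)}.
  apply: within_continuousD; last exact: c2.
  by move=> t; apply: cvgM; [exact: cvg_cst|exact: c1].
apply: subspace_eq_continuous h => t; rewrite inE /= in_itv /= => tT.
by have [e _] := tderivs_lin c C1 C2 js tT; exact: esym e.
Qed.

(** The two claims are proved together: the value at order $j+1$ is read off the limit at order $j$.
    With zero as second summand, [Cn_on_lin] also covers plain multiples. *)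
Lemma tderivs0 j t : 0 <= t <= T -> tderivs T j (fun=> 0) t = 0 :> R /\
  quot_at T (tderivs T j (fun=> 0)) t --> (0 : R).
Proof.
elim: j t => [|j IHj] t tT.
  split=> //; have F := within_itv_dnbhs_proper T0 tT.
  rewrite /quot_at /=; under eq_fun do rewrite subrr mulr0; exact: cvg_cst.
have e0 : forall r, 0 <= r <= T -> tderivs T j.+1 (fun=> 0) r = 0 :> R.
  move=> r rT; rewrite /tderivs iterS -/(tderivs _ _ _).
  by apply: tderiv_val => //; have [] := IHj r rT.
split; first exact: e0.
rewrite (@eq_quot_at _ _ _ (fun=> 0))//.
have F := within_itv_dnbhs_proper T0 tT.
rewrite /quot_at /=; under eq_fun do rewrite subrr mulr0; exact: cvg_cst.
Qed.

Lemma Cn_on0 s : Cn_on T s (fun=> 0).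
Proof.
split=> [j js|j t js tT]; last by have [_ h] := tderivs0 j tT; exact: cvgP h.
have h : {within `[0, T], continuous (fun=> 0 : R)} by move=> t; exact: cvg_cst.
apply: subspace_eq_continuous h => t; rewrite inE /= in_itv /= => tT.
by have [e _] := tderivs0 j tT; exact: esym e.
Qed.

Lemma Cn_on_sum s (I : Type) (r : seq I) (P : pred I) (g : I -> R -> R) :
  (forall i, P i -> Cn_on T s (g i)) -> Cn_on T s (fun t => \sum_(i <- r | P i) g i t).
Proof.
move=> Cg; elim: r => [|i r IHr].
  by under eq_fun do rewrite big_nil; exact: Cn_on0.
under eq_fun do rewrite big_cons.
have [Pi|//] := boolP (P i).
under eq_fun do rewrite -[g i _]mul1r.
by apply: Cn_on_lin => //; exact: Cg.
Qed.

End Cn_on_linear.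

Section finite_sums.
Variables (d : measure_display) (X : measurableType d) (R : realType).
Variable mu : {measure set X -> \bar R}.

Lemma integrable_mulc (c : R) (g : X -> R) :
  mu.-integrable [set: X] (EFin \o g) ->
  mu.-integrable [set: X] (EFin \o (fun y => c * g y)).
Proof.
move=> ig; have := integrableZl measurableT c ig.
by apply: eq_integrable => // y _ /=; rewrite EFinM.
Qed.

(** Integrability and value go through one induction, since additivity requires the rest of the sum
    to be integrable. Membership in [r] is kept in the hypothesis because it carries the range of
    the degrees [l]. *)
Lemma Rintegral_sum (I : eqType) (r : seq I) (P : pred I) (g : I -> X -> R) :
  (forall i, i \in r -> P i -> mu.-integrable [set: X] (EFin \o g i)) ->
  mu.-integrable [set: X] (EFin \o (fun y => \sum_(i <- r | P i) g i y)) /\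
  \int[mu]_y (\sum_(i <- r | P i) g i y) = \sum_(i <- r | P i) \int[mu]_y g i y.
Proof.
elim: r => [|i r IHr] ig.
  have -> : (fun y => \sum_(i <- [::] | P i) g i y) = cst 0.
    by apply/funext => y; rewrite big_nil.
  by rewrite big_nil Rintegral_cst// mul0r; split=> //; exact: integrable0.
have [|ir Er] := IHr; first by move=> j jr; apply: ig; rewrite inE jr orbT.
have -> : (fun y => \sum_(j <- i :: r | P j) g j y) = (fun y =>
    if P i then g i y + \sum_(j <- r | P j) g j y else \sum_(j <- r | P j) g j y).
  by apply/funext => y; rewrite big_cons.
rewrite big_cons; have [Pi|//] := boolP (P i).
have ii := ig i (mem_head _ _) Pi; split; last by rewrite RintegralD// Er.
have := integrableD measurableT ii ir.
by apply: eq_integrable => // y _ /=; rewrite EFinD.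
Qed.

End finite_sums.

(** * Moments against functions of polynomial growth *)

Section moments.
Variables (R : realType) (n : nat) (lam T : R) (U : set 'rV[R]_n).
Hypotheses (n0 : (0 < n)%N) (T0 : 0 < T) (bU : bounded_set U).
Variables (s k : nat) (delta : R) (g : 'rV[R]_n -> R -> R).
Hypothesis gsp : space2sk lam T U s k delta g.

Lemma space2sk_bound_le j0 : (j0 <= s)%N -> exists2 C, 0 <= C &
  forall j x t, (j <= j0)%N -> 0 <= t <= T ->
    `|tderivs T j (g x) t| <= C * weight x `^ (- delta).
Proof.
elim: j0 => [|j0 IHj0] js.
  have [C C0 gC] := space2sk_bound n0 (ltW T0) bU gsp js.
  by exists C => // j x t; rewrite leqn0 => /eqP ->; exact: gC.
have [C C0 gC] := IHj0 (ltnW js).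
have [D D0 gD] := space2sk_bound n0 (ltW T0) bU gsp js.
exists (C + D) => [|j x t jj tT]; first exact: addr_ge0.
move: jj; rewrite leq_eqVlt => /orP[/eqP ->|jj].
  by apply: le_trans (gD x t tT) _; rewrite ler_wpM2r ?powR_ge0// lerDr.
by apply: le_trans (gC j x t jj tT) _; rewrite ler_wpM2r ?powR_ge0// lerDl.
Qed.

Lemma Cn_on_moment (c : 'rV[R]_n -> R) K N :
  measurable_fun [set: 'rV[R]_n] c -> 0 <= K ->
  (forall y, `|c y| <= K * weight y ^+ N) -> (n + N)%:R < delta ->
  Cn_on T s (fun t => \int[lebesgue_rV R n]_y (c y * g y t)) /\
  forall t, 0 <= t <= T -> (lebesgue_rV R n).-integrable [set: 'rV[R]_n]
    (EFin \o (fun y => c y * g y t)).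
Proof.
move=> mc K0 cK nNd.
have [C C0 gC] := space2sk_bound_le (leqnn s).
(* Growth of order [N] uses up [N] of the decay; what remains exceeds $n$. The same [G] serves all
   orders $j \leqslant s$ and all times. *)
pose G (y : 'rV[R]_n) : R := K * C * weight y `^ (- (delta - N%:R)).
have lin0 y j t : (j <= s)%N -> 0 <= t <= T ->
    tderivs T j (fun t => c y * g y t) t = c y * tderivs T j (g y) t.
  move=> js tT.
  have [+ _] := tderivs_lin T0 (c y) (space2sk_Cn_on y gsp) (Cn_on0 T0 s) js tT.
  have [-> _] := tderivs0 T0 j tT.
  rewrite addr0 => <-; apply: eq_tderivs => // r rT; by rewrite addr0.
have GE y : G y = K * weight y ^+ N * (C * weight y `^ (- delta)).
  rewrite /G opprB addrC powRD; last first.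
    by apply/implyP => _; rewrite gt_eqF// weight_gt0.
  by rewrite powR_mulrn ?(ltW (weight_gt0 y))//; ring.
have iG : (lebesgue_rV R n).-integrable [set: 'rV[R]_n] (EFin \o G).
  apply: (@integrable_decay _ _ _ (K * C) (delta - N%:R)).
  - by apply: measurable_funM => //; exact: measurable_weight_powR.
  - exact: mulr_ge0.
  - by rewrite ltrBrDr -natrD.
  - by move=> y; rewrite ger0_norm// !mulr_ge0// powR_ge0.
have bnd j t y : (j <= s)%N -> 0 <= t <= T ->
    `|tderivs T j (fun t => c y * g y t) t| <= G y.
  by move=> js tT; rewrite lin0// normrM GE ler_pM// gC.
have mes j t : (j <= s)%N -> 0 <= t <= T ->
  measurable_fun [set: 'rV[R]_n] (fun y => tderivs T j (fun t => c y * g y t) t).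
  move=> js tT; under eq_fun do rewrite lin0//.
  by apply: measurable_funM => //; exact: space2sk_measurable gsp js tT.
split.
  apply: (Cn_on_Rintegral T0 iG) => // y.
  have := Cn_on_lin T0 (c y) (space2sk_Cn_on y gsp) (Cn_on0 T0 s).
  by under eq_fun do rewrite addr0.
move=> t tT; apply: le_integrable iG => //.
  by apply/measurable_EFinP; exact: (mes 0%N t (leq0n s) tT).
move=> y _ /=; rewrite lee_fin; apply: le_trans (ler_norm _).
exact: (bnd 0%N).
Qed.

Lemma integrable_newton_moment z i c t : (2 <= n)%N -> n%:R < delta -> 0 <= t <= T ->
  (lebesgue_rV R n).-integrable [set: 'rV[R]_n]
    (EFin \o (fun y => g y t * pderiv i (fun x => fundsol (z - x) * c) y)).
Proof.
move=> n2 nd tT; have [C C0 gC] := space2sk_bound n0 (ltW T0) bU gsp (leq0n s).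
apply: (integrable_newton n2 z i c _ C0 nd).
  exact: (space2sk_measurable gsp (leq0n s) tT).
by move=> y; exact: gC.
Qed.

End moments.

(** * Coefficients of the multipole kernels *)

Section multipoles.
Variables (R : realType) (n : nat).

Lemma pderiv_meval (p : mpoly n R) (c : R) i (y : 'rV[R]_n) :
  pderiv i (fun z => meval (fun j => z 0 j) p * c) y =
  c * meval (fun j => y 0 j) (mderiv i p).
Proof.
have h := is_derive_meval p y i.
have hc : is_derive y (delta_mx 0 i) (fun z : 'rV[R]_n => meval (fun j => z 0 j) p * c)
    (c * meval (fun j => y 0 j) (mderiv i p)).
  have := is_deriveZ c h.
  congr (is_derive _ _ _ _); apply/funext => z; exact: mulrC.
exact: derive_val.
Qed.

Lemma ext_d_adj_meval (p : mpoly n R) (b : extform R n) y L :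
  ext_d_adj (fun z K => meval (fun j => z 0 j) p * b K) y L =
  - \sum_(i | i \notin L)
     wsign R [set i]%SET L * (b (i |: L)%SET * meval (fun j => y 0 j) (mderiv i p)).
Proof. by congr (- _); apply: eq_bigr => i _; rewrite pderiv_meval. Qed.

Lemma measurable_ext_d_adj_meval (p : mpoly n R) (b : extform R n) L :
  measurable_fun [set: 'rV[R]_n]
    (fun y => ext_d_adj (fun z K => meval (fun j => z 0 j) p * b K) y L).
Proof.
under eq_fun do rewrite ext_d_adj_meval big_mkcond.
apply: measurableT_comp => //.
apply: measurable_sum => i; case: (i \notin L) => //.
apply: measurable_funM => //.
by apply: measurable_funM => //; exact: measurable_meval.
Qed.

(** The adjoint of $d$ differentiates once, which lowers the degree to $l-1$; this is why the sum
    may run up to $l=m+1$. *)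
Lemma ext_d_adj_meval_bound (p : mpoly n R) (b : extform R n) L l :
  p \is ishomog1 l mdeg -> exists2 C, 0 <= C & forall y,
    `|ext_d_adj (fun z K => meval (fun j => z 0 j) p * b K) y L| <=
      C * weight y ^+ l.-1.
Proof.
move=> pl.
have /choice[C hC] : forall i, exists C, 0 <= C /\
    forall y : 'rV[R]_n, `|meval (fun j => y 0 j) (mderiv i p)| <= C * weight y ^+ l.-1.
  by move=> i; have [C C0 hC] := meval_homog_bound (mderiv_ishomog i pl); exists C.
exists (\sum_(i | i \notin L) `|wsign R [set i]%SET L| * (`|b (i |: L)%SET| * C i)).
  by apply: sumr_ge0 => i _; rewrite !mulr_ge0//; have [] := hC i.
move=> y; rewrite ext_d_adj_meval normrN mulr_suml.
apply: le_trans (ler_norm_sum _ _ _) _; apply: ler_sum => i _.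
by rewrite !normrM -!mulrA !ler_wpM2l//; have [_] := hC i; exact.
Qed.

Lemma wedge_top p (a b : extform R n) : form_degree p a ->
  wedge a b [set: 'I_n]%SET =
  \sum_(I : {set 'I_n} | #|I| == p) wsign R I (~: I) * a I * b (~: I)%SET.
Proof.
move=> ap; rewrite /wedge [LHS]big_mkcond [RHS]big_mkcond.
apply: eq_bigr => I _; rewrite finset.subsetT finset.setTD.
by case: ifPn => // /ap ->; rewrite mulr0 mul0r.
Qed.

End multipoles.

(** * The moments *)

Section finite_rank.
Variables (R : realType) (n s k m q : nat) (lam delta T : R) (U : set 'rV[R]_n).
Variables (J : nat -> nat) (h : nat -> nat -> mpoly n R) (theta : 'rV[R]_n -> R).
Hypotheses (n2 : (2 <= n)%N) (nmd : (n + m)%:R < delta) (T0 : 0 < T).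
Hypothesis bU : bounded_set U.
Hypothesis hl : forall l j, (j < J l)%N -> h l j \is ishomog1 l mdeg.
Variable f : tform R n.
Hypothesis fdeg : forall x t, 0 <= t <= T -> form_degree q.+1 (f x t).
Hypothesis fsp : forall I : {set 'I_n}, #|I| = q.+1 ->
  space2sk lam T U s k delta (fun x t => f x t I).
Implicit Types I K : {set 'I_n}.

Let n0 : (0 < n)%N := ltnW n2.

(** The factor of $f_K$ in the top-degree coefficient of $-f \wedge (d^{n-q-1})^*(h_l^{(j)} \star
    dx_I)$; only the component on the complement of $K$ pairs with $dx_K$. *)
Definition moment_ker I l j K (y : 'rV[R]_n) : R :=
  - (wsign R K (~: K) *
    ext_d_adj (fun z L => hfun h l j z * hodge (dform R I) L) y (~: K)%SET).

Definition moment I l j (t : R) : R :=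
  \sum_(K : {set 'I_n} | #|K| == q.+1)
    \int[lebesgue_rV R n]_y (moment_ker I l j K y * f y t K).

Lemma moment_term I l j K : (1 <= l <= m.+1)%N -> (j < J l)%N -> #|K| = q.+1 ->
  Cn_on T s (fun t => \int[lebesgue_rV R n]_y (moment_ker I l j K y * f y t K)) /\
  forall t, 0 <= t <= T -> (lebesgue_rV R n).-integrable [set: 'rV[R]_n]
    (EFin \o (fun y => moment_ker I l j K y * f y t K)).
Proof.
move=> /andP[l1 lm] jJ Kq.
have [C C0 hC] :=
  ext_d_adj_meval_bound (hodge (dform R I)) (~: K)%SET (hl jJ).
apply: (Cn_on_moment n0 T0 bU (fsp Kq) (K := `|wsign R K (~: K)| * C) (N := l.-1)).
- apply: measurableT_comp => //; apply: measurable_funM => //.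
  exact: measurable_ext_d_adj_meval.
- exact: mulr_ge0.
- by move=> y; rewrite normrN normrM -mulrA ler_wpM2l.
- apply: le_lt_trans nmd; rewrite ler_nat leq_add2l.
  by rewrite -ltnS prednK.
Qed.

Lemma Cn_on_multipole_moment I l j : (1 <= l <= m.+1)%N -> (j < J l)%N ->
  Cn_on T s (moment I l j).
Proof.
move=> lm jJ; apply: Cn_on_sum => // K /eqP Kq.
by have [] := moment_term I lm jJ Kq.
Qed.

(* Needed for the integral of f /\ phi_m to split: if f /\ phi were not
   integrable, both potentials would be the junk value 0. *)
Lemma integrable_phi_ker t x I : 0 <= t <= T -> #|I| = q ->
  (lebesgue_rV R n).-integrable [set: 'rV[R]_n]
    (EFin \o (fun y => wedge (f y t) (phi_ker q x y I) [set: 'I_n]%SET)).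
Proof.
move=> tT Iq.
pose g K i (y : 'rV[R]_n) : R := - (wsign R K (~: K) * wsign R [set i]%SET (~: K)) *
  (f y t K * pderiv i (fun z => fundsol (x - z) * hodge (dform R I) (i |: ~: K)%SET) y).
rewrite (_ : (fun y => _) = fun y => \sum_(K : {set 'I_n} | #|K| == q.+1)
    \sum_(i | i \notin (~: K)%SET) g K i y); last first.
  apply/funext => y; rewrite (wedge_top _ (fdeg y tT)); apply: eq_bigr => K _.
  rewrite /phi_ker Iq eqxx /ext_d_adj mulrN mulr_sumr -sumrN.
  by apply: eq_bigr => i _; rewrite /g; ring.
apply: (Rintegral_sum _).1 => K _ /eqP Kq.
apply: (Rintegral_sum _).1 => i _ _; apply: integrable_mulc.
apply: (integrable_newton_moment n0 T0 bU (fsp Kq)) => //.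
by apply: le_lt_trans nmd; rewrite ler_nat leq_addr.
Qed.

Lemma wedge_phim_ker t x y I : 0 <= t <= T -> #|I| = q ->
  wedge (f y t) (phim_ker J h theta m q x y I) [set: 'I_n]%SET =
  wedge (f y t) (phi_ker q x y I) [set: 'I_n]%SET -
  \sum_(1 <= l < m.+2) \sum_(j < J l) hterm h theta l j x *
    \sum_(K : {set 'I_n} | #|K| == q.+1) moment_ker I l j K y * f y t K.
Proof.
move=> tT Iq; rewrite !(wedge_top _ (fdeg y tT)) /phim_ker Iq eqxx.
under eq_bigr do rewrite mulrDr.
rewrite big_split/=; congr (_ + _).
under eq_bigr do rewrite mulr_sumr.
rewrite exchange_big/= -sumrN; apply: eq_bigr => l _.
under eq_bigr do rewrite mulr_sumr.
rewrite exchange_big/= -sumrN; apply: eq_bigr => j _.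
rewrite mulr_sumr -sumrN; apply: eq_bigr => K _.
by rewrite /moment_ker; ring.
Qed.

Lemma potential_diff t x I : 0 <= t <= T ->
  potential (phi_ker q) f x t I - potential (phim_ker J h theta m q) f x t I =
  multipole J h theta m q moment x t I.
Proof.
move=> tT; rewrite /multipole; case: ifPn => [/eqP Iq|Iq]; last first.
  (* For $|I| \neq q$ the multipole vanishes and the two kernels coincide. *)
  apply/eqP; rewrite subr_eq0; apply/eqP; apply: eq_Rintegral => y _.
  congr wedge; apply/funext => K.
  by rewrite /phim_ker /phi_ker (negbTE Iq) addr0.
(* The integral against [phi_ker] is hidden in [A], so that only the other integrand is expanded;
   [A] cancels once that integral is split. *)
rewrite /potential; set A := Rintegral _ _ _.
under eq_Rintegral do rewrite wedge_phim_ker//.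
have iK l j K : l \in index_iota 1 m.+2 -> (j < J l)%N -> #|K| == q.+1 ->
    (lebesgue_rV R n).-integrable [set: 'rV[R]_n]
      (EFin \o (fun y => moment_ker I l j K y * f y t K)).
  rewrite mem_index_iota ltnS => lm jJ /eqP Kq.
  by have [_] := moment_term I lm jJ Kq; exact.
have S1 l j : l \in index_iota 1 m.+2 -> (j < J l)%N ->
    (lebesgue_rV R n).-integrable [set: 'rV[R]_n] (EFin \o (fun y =>
      \sum_(K : {set 'I_n} | #|K| == q.+1) moment_ker I l j K y * f y t K)) /\
    \int[lebesgue_rV R n]_y
      (\sum_(K : {set 'I_n} | #|K| == q.+1) moment_ker I l j K y * f y t K) =
    moment I l j t.
  by move=> lm jJ; apply: Rintegral_sum => K _ Kq; exact: iK.
have S2 l : l \in index_iota 1 m.+2 -> _ := fun lm =>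
  @Rintegral_sum _ _ _ (lebesgue_rV R n) _ (index_enum 'I_(J l)) xpredT
    (fun j y => hterm h theta l j x *
      \sum_(K : {set 'I_n} | #|K| == q.+1) moment_ker I l j K y * f y t K)
    (fun j _ _ => integrable_mulc _ (S1 l j lm (ltn_ord j)).1).
have [S3 S3E] := @Rintegral_sum _ _ _ (lebesgue_rV R n) _ (index_iota 1 m.+2) xpredT
  (fun l y => \sum_(j < J l) hterm h theta l j x *
      \sum_(K : {set 'I_n} | #|K| == q.+1) moment_ker I l j K y * f y t K)
  (fun l lm _ => (S2 l lm).1).
rewrite RintegralB//; last exact: integrable_phi_ker.
rewrite -/A opprB addrC subrK S3E !big_seq; apply: eq_bigr => l lm.
rewrite (S2 l lm).2; apply: eq_bigr => j _.
have [i1 <-] := S1 l j lm (ltn_ord j).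
by rewrite RintegralZl// mulrC.
Qed.

End finite_rank.

Theorem mainTheorem4 (R : realType) (n s k m q : nat) (lam delta T : R)
    (U : set 'rV[R]_n) (J : nat -> nat) (h : nat -> nat -> mpoly n R)
    (theta : 'rV[R]_n -> R) :
  (2 <= n)%N -> 0 < lam < 1 ->
  (n + m)%:R - 1 < delta < (n + m)%:R -> 0 < T -> (q <= n - 1)%N ->
  nbhs (0 : 'rV[R]_n) U -> bounded_set U ->
  harmonic_basis J h ->
  smooth theta ->
  (forall x, 2 <= enorm x -> theta x = enorm x) ->
  (forall x, 0 < (theta x)^-1 <= 1) ->
  forall f : tform R n, Zspace lam T U s k (delta + 1) q.+1 f ->
  exists a : {set 'I_n} -> nat -> nat -> R -> R,
    (forall (I : {set 'I_n}) l j, #|I| = q -> (1 <= l <= m.+1)%N -> (j < J l)%N ->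
       Cn_on T s (a I l j)) /\
    (forall x t (K : {set 'I_n}), 0 <= t <= T ->
       d_Phi_diff J h theta m q f x t K =
       ext_d (fun z => multipole J h theta m q a z t) x K).
Proof.
move=> n2 _ /andP[nmd _] T0 _ _ bU [_ hh _ _] _ _ _ f [fdeg fsp _].
(* The forms lie in the space of weight [delta + 1], so the lower bound on [delta] is exactly what
   moments of degree up to $m$ require. *)
have nmd1 : (n + m)%:R < delta + 1 by rewrite -ltrBlDr.
have hl l j : (j < J l)%N -> h l j \is ishomog1 l mdeg by move=> /hh[].
exists (moment q h f); split=> [I l j _ lm jJ|x t K tT].
  exact: (Cn_on_multipole_moment n2 nmd1 T0 bU hl fsp).
rewrite /d_Phi_diff; congr (ext_d _ x K); apply/funext => z; apply/funext => I.
exact: (potential_diff theta n2 nmd1 T0 bU hl fdeg fsp).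
Qed.
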